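(* For a torus fixed point $[Z]\in\mathrm{Hilb}^n(\mathbb{C}^d)^T$, the class $$\sum_i(-1)^i\,\mathrm{Ext}^i(I_Z,I_Z)_0\in K_T(\mathrm{pt})$$ has no negative non-zero $T$-constant term (that is, the coefficient of the trivial $T$-character is $\geq 0$) in each of the following cases: (1) $d>0$ is odd and $[Z]$ is any $T$-fixed point (any $n$). (2) $d=2$ or $d=4$, and $[Z]$ is any $T$-fixed point (any $n$). (3) $d>0$, $d\equiv 0\bmod 4$, and $Z=Z_\pi$ with $|\pi|=1$. (4) $d=8$ and $Z=Z_\pi$ with $|\pi|<7$. (5) $d=8$ and $Z=Z_\pi$ where $\pi$ is one of the three $7$-partitions (of sizes $9,10,14$) with character $Z_\pi$ equal to $1+t_1+t_2+t_3+t_4+t_5+t_6+t_7+t_8$, or $1+t_1+t_2+t_3+t_4+t_5+t_6+t_7+t_8+t_8^2$, or $1+t_1+t_2+t_3+t_1t_2+t_1t_3+t_2t_3+t_1t_2t_3+t_4+t_5+t_6+t_7+t_8+t_8^2$. (6) $d=12$ and $Z=Z_\pi$ with $|\pi|<5$.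
   Context: A $(d-1)$-partition is a family $\pi=\{\pi_{i_1\ldots i_{d-1}}\}_{i_1,\ldots,i_{d-1}\geq 1}$ of non-negative integers, weakly decreasing in each index, with finite size $|\pi|:=\sum\pi_{i_1\ldots i_{d-1}}$. $(\mathbb{C}^* )^d$ acts on $\mathbb{C}^d$ in the standard way, the coordinate function $x_i$ having character $t_i$, and $T=\{t_1\cdots t_d=1\}\subset(\mathbb{C}^* )^d$ is the Calabi-Yau subtorus. $\mathrm{Hilb}^n(\mathbb{C}^d)$ is the Hilbert scheme of $n$ points and $I_Z$ is the ideal sheaf of $Z$. For $d\geq 2$ the $T$-fixed points of $\mathrm{Hilb}^n(\mathbb{C}^d)$ coincide with the $(\mathbb{C}^* )^d$-fixed points and are the subschemes $Z_\pi$, $|\pi|=n$, with ideal $I_{Z_\pi}=\langle x_1^{i_1-1}\cdots x_{d-1}^{i_{d-1}-1}x_d^{\pi_{i_1\ldots i_{d-1}}}\rangle_{i_1,\ldots,i_{d-1}\geq 1}$. The character of $H^0(\mathcal{O}_{Z_\pi})$, also denoted $Z_\pi$, is $\sum_{i_1,\ldots,i_{d-1}\geq 1}\sum_{m=1}^{\pi_{i_1\ldots i_{d-1}}}t_1^{i_1-1}\cdots t_{d-1}^{i_{d-1}-1}t_d^{m-1}$. $\mathrm{Ext}^i(I_Z,I_Z)_0$ is the trace-free part (kernel of the trace map to $H^i(\mathcal{O}_{\mathbb{C}^d})$), and $K_T(\mathrm{pt})=\mathbb{Z}[t_1^{\pm1},\ldots,t_d^{\pm1}]/(t_1\cdots t_d-1)$.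 *)

(* Defs.v *)
From HB Require Import structures.
From mathcomp Require Import all_boot all_order all_algebra.
From mathcomp Require Import finmap.
From mathcomp Require Import mpoly.
From mathcomp Require Import complex.
From mathcomp Require Import reals.

Set Implicit Arguments.
Unset Strict Implicit.
Unset Printing Implicit Defensive.

Import Order.TTheory GRing.Theory Num.Theory.
Local Open Scope ring_scope.

(* The coordinate ring of C^d, where C = complex R and R is any model of the
   real numbers. *)
Notation Cpoly R d := {mpoly (complex R)[d]}.

Section Ideals.
Variables (R : realType) (d : nat).
Local Notation C := (complex R).
Local Notation S := (Cpoly R d).

(* The unit ideal is allowed: it is the ideal of the empty subscheme. *)
Definition is_ideal (I : S -> Prop) : Prop :=
  [/\ I 0, (forall f g, I f -> I g -> I (f + g))
    & (forall a f, I f -> I (a * f))].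

Definition ideal_gen (G : S -> Prop) (f : S) : Prop :=
  exists k (a g : 'I_k -> S),
    (forall j, G (g j)) /\ f = \sum_(j < k) a j * g j.

(* For complex subspaces B \subset A of an S-module: dim_C (A / B) = k, i.e.
   A / B has a basis with k elements. *)
Definition dim_quot (V : lmodType S) (A B : V -> Prop) (k : nat) : Prop :=
  exists v : 'I_k -> V, (forall j, A (v j)) /\
    forall z, A z ->
      exists! a : 'rV[C]_k, B (z - \sum_(j < k) (a 0 j)%:MP *: v j).

End Ideals.

Section Torus.
Variables (R : realType) (d : nat).
Local Notation C := (complex R).
Local Notation S := (Cpoly R d).

Definition CY_torus (t : 'I_d -> C) : Prop := \prod_i t i = 1.

(* Characters of (C^* )^d. Their restrictions to T exhaust the characters of T,
   and 0 restricts to the trivial one. *)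
Definition weight := {ffun 'I_d -> int}.

Definition weight_val (w : weight) (t : 'I_d -> C) : C := \prod_i t i ^ w i.

Definition torus_act (t : 'I_d -> C) (f : S) : S :=
  f \mPo [tuple t i *: 'X_i | i < d].

(* f is a T-eigenvector whose character is the restriction of w to T. *)
Definition T_semi_invariant (w : weight) (f : S) : Prop :=
  forall t, CY_torus t -> torus_act t f = weight_val w t *: f.

(* I is the ideal of a T-fixed point of Hilb^n(C^d). *)
Definition T_fixed_point (n : nat) (I : S -> Prop) : Prop :=
  [/\ is_ideal I,
      dim_quot (V := S^o) (fun=> True) I n
    & forall t f, CY_torus t -> I f -> I (torus_act t f)].

End Torus.

(* A bounded resolution
     0 -> F_len -> ... -> F_1 -> F_0 -> I -> 0
   by T-equivariant free modules of finite rank. F_i is the module of row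
   vectors of length res_rk i, and its j-th basis vector e_(i,j) has T-character
   res_wt i j. Homomorphisms of free modules act on row vectors by right
   multiplication. *)
Record equivariant_resolution (R : realType) (d : nat)
    (I : Cpoly R d -> Prop) := EquivariantResolution {
  res_len : nat;
  res_rk : nat -> nat;
  res_wt : forall i, 'I_(res_rk i) -> weight d;
  res_diff : forall i, 'M[Cpoly R d]_(res_rk i.+1, res_rk i);
  res_aug : 'cV[Cpoly R d]_(res_rk 0);
  res_bounded : forall i, (res_len < i)%N -> res_rk i = 0%N;
  res_diff_equivariant : forall i j k,
    T_semi_invariant (res_wt j - res_wt k) (res_diff i j k);
  res_aug_equivariant : forall j, T_semi_invariant (res_wt j) (res_aug j 0);
  res_aug_image : forall f,
    I f <-> exists v : 'rV_(res_rk 0), f = (v *m res_aug) 0 0;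
  res_exact0 : forall v : 'rV_(res_rk 0),
    v *m res_aug = 0 <-> exists u : 'rV_(res_rk 1), v = u *m res_diff 0;
  res_exact : forall i (v : 'rV_(res_rk i.+1)),
    v *m res_diff i = 0 <->
    exists u : 'rV_(res_rk i.+2), v = u *m res_diff i.+1
}.

Section Ext.
Variables (R : realType) (d : nat) (I : Cpoly R d -> Prop).
Variable F : equivariant_resolution I.
Local Notation S := (Cpoly R d).
Local Notation cochain i := ('cV[S]_(res_rk F i)).

(* A homomorphism phi : F_i -> I is the column vector c of its values on the
   basis, and T acts by (t phi)(v) = t (phi (t^-1 v)). Hence phi has character w
   iff each value phi e_(i,j) has character w + res_wt i j. *)
Definition Hom_weight (w : weight d) (i : nat) (c : cochain i) : Prop :=
  forall j, I (c j 0) /\ T_semi_invariant (w + res_wt j) (c j 0).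

(* A homomorphism I -> I, given by its composition c with F_0 -> I, has
   trace f: since I has rank one, the trace is the function f such that the
   homomorphism is multiplication by f. *)
Definition Hom_trace (c : cochain 0) (f : S) : Prop :=
  forall v : 'rV_(res_rk F 0), (v *m c) 0 0 = f * (v *m res_aug F) 0 0.

(* The trace maps Ext^i to H^i(O), which vanishes for i > 0. *)
Definition trace_free (i : nat) : cochain i -> Prop :=
  if i is 0 then fun c => Hom_trace c 0 else fun=> True.

Definition Ext0_cocycle (w : weight d) (i : nat) (c : cochain i) : Prop :=
  [/\ Hom_weight w c, res_diff F i *m c = 0 & trace_free c].

Definition Ext_coboundary (w : weight d) (i : nat) : cochain i -> Prop :=
  match i with
  | 0 => fun c => c = 0
  | i'.+1 => fun c =>
      exists b : cochain i', Hom_weight w b /\ c = res_diff F i' *m b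
  end.

(* The T-character w has (finite) multiplicity k in Ext^i(I, I)_0. *)
Definition Ext0_mult (w : weight d) (i k : nat) : Prop :=
  dim_quot (@Ext0_cocycle w i) (@Ext_coboundary w i) k.

(* c is the coefficient of the T-character w in
   \sum_i (-1)^i Ext^i(I, I)_0 \in K_T(pt). *)
Definition Ext0_class_coef (w : weight d) (c : int) : Prop :=
  exists2 m : nat -> nat, (forall i, Ext0_mult w i (m i)) &
    c = \sum_(i < (res_len F).+1) (-1) ^+ i * (m i)%:Z.

End Ext.

Section Partitions.
Variable d : nat.

(* A (d-1)-partition, with indices starting from 0 instead of 1; finite size
   is finiteness of the support. *)
Notation finsupp_array := {fsfun 'X_{1..d.-1} -> nat with 0%N}.

Definition is_partition (pi : finsupp_array) : Prop :=
  forall (i : 'X_{1..d.-1}) (j : 'I_d.-1), (pi (i + U_(j))%MM <= pi i)%N.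

Definition psize (pi : finsupp_array) : nat :=
  (\sum_(i <- finsupp pi) pi i)%N.

(* The exponent of x_1^(i_1) ... x_(d-1)^(i_(d-1)) x_d^m, for d > 0. *)
Definition box (i : 'X_{1..d.-1}) (m : nat) : 'X_{1..d} :=
  [multinom (if insub (val j) is Some k then i k else m) | j < d].

Definition pcharacter (pi : finsupp_array) : {mpoly int[d]} :=
  \sum_(i <- finsupp pi) \sum_(m < pi i) 'X_[box i m].

Definition partition_ideal (R : realType) (pi : finsupp_array) :
    Cpoly R d -> Prop :=
  ideal_gen (fun g => exists i, g = 'X_[box i (pi i)]).

(* The variable t_k, with k counted from 1. *)
Definition tvar (k : nat) : {mpoly int[d]} :=
  'X_[[multinom nat_of_bool ((val j).+1 == k) | j < d]].

(* I is the ideal of Z_pi for some (d-1)-partition pi satisfying P. *)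
Definition is_Z_pi_with (R : realType) (I : Cpoly R d -> Prop)
    (P : finsupp_array -> Prop) : Prop :=
  exists pi : finsupp_array,
    [/\ is_partition pi, P pi & forall f, I f <-> partition_ideal pi f].

End Partitions.

(* The characters of the three exceptional 7-partitions, used with d = 8. *)
Section ExceptionalCharacters.
Variable d : nat.
Local Notation t := (tvar d).

Definition character9 : {mpoly int[d]} :=
  1 + t 1 + t 2 + t 3 + t 4 + t 5 + t 6 + t 7 + t 8.

Definition character10 : {mpoly int[d]} :=
  1 + t 1 + t 2 + t 3 + t 4 + t 5 + t 6 + t 7 + t 8 + t 8 ^+ 2.

Definition character14 : {mpoly int[d]} :=
  1 + t 1 + t 2 + t 3 + t 1 * t 2 + t 1 * t 3 + t 2 * t 3 + t 1 * t 2 * t 3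
  + t 4 + t 5 + t 6 + t 7 + t 8 + t 8 ^+ 2.

End ExceptionalCharacters.

(* Main.v *)
Require Import Defs.
From mathcomp Require Import all_boot all_order all_algebra.
From mathcomp Require Import finmap mpoly complex reals.
From mathcomp Require Import boolp ring zify.
Local Open Scope ring_scope.

(* The coefficient of the trivial character vanishes at every T-fixed point, in
   every dimension.

   Let d >= 2 and x = x_0. A T-fixed ideal I is monomial; let pi be the finite
   set of exponents outside I. All weights are taken modulo (1, ..., 1). The
   module Q = S[1/x] / I has finite-dimensional weight spaces, of dimension
   q(w), and the S-dual of F becomes exact in positive degrees when x is inverted,
   because a power of x lies in I. Hence Ext^(i+1)(I, I)_0 and H^i(Hom(F, Q)) agree in weight 0, so
   that the coefficient is minus the alternating sum of the q(wt) over the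
   weights wt of the generators of F. Likewise F (x) S[1/x] / S resolves Q, which
   expresses q through these weights and gives, with Z the character of S / I,
     sum +- t^wt = 1 - Z (1 - t_1) ... (1 - t_d).
   The coefficient is thus
     sum_(p in pi) sum_A (-1)^|A| q(p + 1_A) - q(0).
   Write q = r + z, where r counts the monomials with negative exponent of x and z
   those in pi. The iterated difference of r is concentrated in 0, which gives
   -(-1)^d z(0). In the sum for z one counts the p' in pi of the form
   p + 1_A + k (1, ..., 1). For k >= 0 and fixed p', the exponent p lies in pi as
   soon as it is nonnegative, and the signed sum over A is 1 if p' is constant and
   0 otherwise: the total is z(0). Exchanging p with p' and A with its complement
   replaces k by -1 - k, so that the terms with k < 0 give (-1)^d z(0). Finally
   q(0) = z(0).

   For d = 1 the torus is trivial, I is principal and all the groups vanish. *)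

Set Implicit Arguments.
Unset Strict Implicit.
Unset Printing Implicit Defensive.
Import Order.TTheory GRing.Theory Num.Theory.

(** * Dimensions of subquotients *)

Section QuotientDimension.
Variables (R : realType) (d : nat).
Local Notation C := (complex R).
Local Notation S := (Cpoly R d).

Definition subspace (V : lmodType S) (P : V -> Prop) : Prop :=
  [/\ P 0, (forall u v, P u -> P v -> P (u + v))
    & forall c u, P u -> P (c%:MP *: u)].

Definition lincomb (V : lmodType S) k (v : 'I_k -> V) (a : 'rV[C]_k) : V :=
  \sum_j (a 0 j)%:MP *: v j.

Section Lincomb.
Variables (V : lmodType S) (k : nat) (v : 'I_k -> V).

Lemma lincomb0 : lincomb v 0 = 0.
Proof. by rewrite /lincomb big1 // => j _; rewrite mxE mpolyC0 scale0r. Qed.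

Lemma lincombD a b : lincomb v (a + b) = lincomb v a + lincomb v b.
Proof.
by rewrite /lincomb -big_split; apply: eq_bigr => j _; rewrite mxE mpolyCD scalerDl.
Qed.

Lemma lincombZ c a : lincomb v (c *: a) = c%:MP *: lincomb v a.
Proof.
rewrite /lincomb scaler_sumr; apply: eq_bigr => j _.
by rewrite mxE mpolyCM scalerA.
Qed.

Lemma lincombB a b : lincomb v (a - b) = lincomb v a - lincomb v b.
Proof. by rewrite lincombD -[- b]scaleN1r lincombZ mpolyCN mpolyC1 scaleN1r. Qed.

Lemma lincombM m (B : 'M[C]_(m, k)) a :
  lincomb v (a *m B) = lincomb (fun j => lincomb v (row j B)) a.
Proof.
rewrite /lincomb (eq_bigr (fun j => \sum_i (a 0 i)%:MP *: ((B i j)%:MP *: v j))).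
  2: move=> j _; rewrite mxE (raddf_sum (@mpolyC d C)) scaler_suml.
  2: by apply: eq_bigr => i _; rewrite /= mpolyCM scalerA.
rewrite exchange_big; apply: eq_bigr => i _; rewrite scaler_sumr.
by apply: eq_bigr => j _; rewrite !mxE.
Qed.

Lemma lincomb_closed P a : subspace P -> (forall j, P (v j)) -> P (lincomb v a).
Proof. by case=> P0 PD PZ Pv; apply: (big_ind P) => // j _; apply: PZ. Qed.

End Lincomb.

Lemma lincomb_map (V W : lmodType S) (f : {linear V -> W}) k (v : 'I_k -> V) a :
  f (lincomb v a) = lincomb (fun j => f (v j)) a.
Proof. by rewrite /lincomb linear_sum; apply: eq_bigr => j _; rewrite linearZ. Qed.

Section Subspaces.
Variable V : lmodType S.
Implicit Types A B P : V -> Prop.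

Lemma subspaceN P v : subspace P -> P v -> P (- v).
Proof. by case=> _ _ PZ Pv; rewrite -scaleN1r -mpolyC1 -mpolyCN; apply: PZ. Qed.

Lemma subspaceB P u v : subspace P -> P u -> P v -> P (u - v).
Proof. by move=> sP Pu Pv; case: (sP) => _ PD _; apply: PD => //; apply: subspaceN. Qed.

Lemma subspace_sum (I : Type) (s : seq I) (Q : pred I) (F : I -> V) P :
  subspace P -> (forall i, Q i -> P (F i)) -> P (\sum_(i <- s | Q i) F i).
Proof. by case=> P0 PD _ PF; apply: (big_ind P). Qed.

Lemma eq_dim_quot A A' B B' k : (forall z, A z <-> A' z) -> (forall z, B z <-> B' z) ->
  dim_quot A B k -> dim_quot A' B' k.
Proof.
move=> eA eB [v [Av hv]]; exists v; split=> [j|z /eA /hv [a [Ba ua]]]; first exact/eA.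
by exists a; split=> [|b /eB /ua //]; apply/eB.
Qed.

(** The difference of two coordinate vectors of one element is a combination lying in [B], so
    freeness modulo [B] gives the uniqueness that [dim_quot] asks for. *)
Lemma dim_quotP (T : finType) A B (v : T -> V) : subspace B ->
  (forall t, A (v t)) ->
  (forall z, A z -> exists a : T -> C, B (z - \sum_t (a t)%:MP *: v t)) ->
  (forall a : T -> C, B (\sum_t (a t)%:MP *: v t) -> forall t, a t = 0) ->
  dim_quot A B #|T|.
Proof.
move=> sB Av gen free; pose w (j : 'I_#|T|) := v (enum_val j).
exists w; split=> [j|z /gen [a Ba]]; first exact: Av.
have E (b : 'rV_#|T|) : lincomb w b =
    \sum_t (b 0 (enum_rank t))%:MP *: v t.
  rewrite [RHS](reindex (@enum_val T predT)) /=; last first.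
    by apply: onW_bij; apply: enum_val_bij.
  by apply: eq_bigr => j _; rewrite enum_valK.
have Ba' : B (z - lincomb w (\row_j a (enum_val j))).
  by rewrite E; under eq_bigr => t _ do rewrite mxE enum_rankK.
exists (\row_j a (enum_val j)); split=> //.
move=> b Bb; apply/rowP => j; rewrite mxE; change (B (z - lincomb w b)) in Bb.
have /(_ (enum_val j)) : forall t, b 0 (enum_rank t) - a t = 0.
  apply: free; under eq_bigr => t _ do rewrite mpolyCB scalerBl.
  rewrite sumrB -E.
  rewrite -[X in B X](_ : (z - \sum_t (a t)%:MP *: v t) -
    (z - lincomb w b) = _); first exact: subspaceB.
  by rewrite opprB addrC addrA subrK.
by rewrite enum_valK => /subr0_eq ->.
Qed.

End Subspaces.
End QuotientDimension.

(** Among the matrices whose row space lies in [Q], take [U] of maximal rank: adjoining a vector of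
    [Q] cannot raise the rank, so the vector is already in the row space. *)
Lemma closed_rowspace (K : fieldType) n (Q : 'rV[K]_n -> Prop) :
  Q 0 -> (forall u v, Q u -> Q v -> Q (u + v)) -> (forall c u, Q u -> Q (c *: u)) ->
  exists U : 'M[K]_n, forall v, Q v <-> (v <= U)%MS.
Proof.
move=> Q0 QD QZ.
pose P r := `[< exists U : 'M[K]_n, (forall v, (v <= U)%MS -> Q v) /\ \rank U = r >].
have exP : exists r, P r.
  exists 0%N; apply/asboolP; exists 0; rewrite mxrank0; split=> // v.
  by rewrite submx0 => /eqP ->.
have ubP r : P r -> (r <= n)%N by case/asboolP => U [_ <-]; apply: rank_leq_col.
case: (ex_maxnP exP ubP) => r /asboolP [U [QU rU]] maxr.
exists U => v; split=> [Qv|]; last exact: QU.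
have sub w : (w <= U + v)%MS -> Q w.
  case/sub_addsmxP => -[a b] /= ->; apply: QD; first by apply/QU/submxMl.
  have -> : b *m v = b 0 0 *: v.
    by apply/rowP => j; rewrite mxE big_ord1 mxE.
  exact: QZ.
have /maxr : P (\rank (U + v)%MS) by apply/asboolP; exists (U + v)%MS.
rewrite -rU => le; apply: (submx_trans (addsmxSr U v)).
by have /mxrank_leqif_sup/leqifP := addsmxSl U v; case: ifP => // _; rewrite ltnNge le.
Qed.

Section DimQuot.
Variables (R : realType) (d : nat).
Local Notation C := (complex R).
Local Notation S := (Cpoly R d).
Variable V : lmodType S.
Implicit Types A B Y : V -> Prop.

(** In a basis of [l < k] elements modulo [B], the coordinate matrix of the [k] vectors has a
    nonzero left kernel. *)
Lemma dim_quot_dependent A B l k (v : 'I_k -> V) : subspace B ->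
  dim_quot A B l -> (forall j, A (v j)) -> (l < k)%N ->
  exists2 c : 'rV[C]_k, c != 0 & B (lincomb v c).
Proof.
move=> sB [w [Aw hw]] Av ltlk.
have /fin_all_exists [m hm] j : exists a : 'rV[C]_l, B (v j - lincomb w a).
  by have [a [Ba _]] := hw _ (Av j); exists a.
pose M := \matrix_(j < k) m j.
have : kermx M != 0.
  rewrite kermx_eq0 -row_leq_rank -ltnNge.
  exact: leq_ltn_trans (rank_leq_col M) ltlk.
case/rowV0Pn => c /sub_kermxP cM0 c0; exists c => //.
have -> : lincomb v c = lincomb (fun j => v j - lincomb w (m j)) c.
  have -> : lincomb (fun j => v j - lincomb w (m j)) c =
      lincomb v c - lincomb (fun j => lincomb w (row j M)) c.
    rewrite /lincomb -sumrB; apply: eq_bigr => j _; rewrite scalerBr.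
    by rewrite rowK.
  by rewrite -lincombM cM0 lincomb0 subr0.
exact: lincomb_closed.
Qed.

Lemma dim_quot_leq A B k l : subspace A -> subspace B ->
  dim_quot A B k -> dim_quot A B l -> (k <= l)%N.
Proof.
move=> sA sB [v [Av hv]] hl; rewrite leqNgt; apply/negP => ltlk.
have [c /eqP c0 Bc] := dim_quot_dependent sB hl Av ltlk.
have A0 : A 0 by case: sA.
have [a [_ ua]] := hv _ A0; apply: c0.
rewrite -(ua c) ?(ua 0) //.
  by rewrite -/(lincomb v 0) lincomb0 subr0; case: sB.
by rewrite -/(lincomb v c) sub0r; apply: subspaceN.
Qed.

Lemma dim_quot_uniq A B k l : subspace A -> subspace B ->
  dim_quot A B k -> dim_quot A B l -> k = l.
Proof.
by move=> sA sB h1 h2; apply/eqP; rewrite eqn_leq !(dim_quot_leq sA sB _ _).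
Qed.

Lemma dim_quot_self A B : subspace B -> (forall z, A z -> B z) -> dim_quot A B 0.
Proof.
move=> sB AB; exists (fun _ => 0); split=> [[]//|z /AB Bz].
by exists 0; split=> [|a _]; [rewrite big_ord0 subr0 | apply/rowP; case].
Qed.

(** Coordinates in a basis of [B / A] turn [Y / A] into a row space [U]. A basis of [U] lifts to one
    of [Y / A], and a basis of a complement of [U] to one of [B / Y]. *)
Lemma dim_quot_between A Y B n : subspace A -> subspace Y -> subspace B ->
  (forall z, A z -> Y z) -> (forall z, Y z -> B z) ->
  dim_quot B A n -> exists k r, [/\ n = (k + r)%N, dim_quot Y A k & dim_quot B Y r].
Proof.
move=> sA sY sB AY YB [v [Bv hv]].
have [Y0 YD YZ] := sY.
have [||c u|U hU] := @closed_rowspace C n (fun a => Y (lincomb v a)).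
- by rewrite lincomb0.
- by move=> a b Ya Yb; rewrite lincombD; apply: YD.
- by rewrite lincombZ; apply: YZ.
have YE z a : A (z - lincomb v a) -> Y z <-> (a <= U)%MS.
  move=> Az; rewrite -hU; split=> Yz.
    by rewrite -[lincomb v a](subKr z); apply: subspaceB (AY _ Az).
  by rewrite -[z](subrK (lincomb v a)); apply: YD => //; apply: AY.
exists (\rank U), (\rank (U^C)%MS); split.
- by rewrite mxrank_compl subnKC // rank_leq_row.
- exists (fun j => lincomb v (row j (row_base U))); split=> [j|z Yz].
    by apply/hU; rewrite (submx_trans (row_sub _ _)) // eq_row_base.
  have [a [Aa ua]] := hv _ (YB _ Yz).
  have aU : (a <= row_base U)%MS by rewrite eq_row_base; apply/(YE z).
  have [b ab] := submxP aU.
  exists b; split; first by rewrite -/(lincomb _ b) -lincombM -ab.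
  move=> c Ac; apply: (row_free_inj (row_base_free U)); rewrite -ab.
  by apply: ua; rewrite -/(lincomb v (c *m _)) lincombM.
exists (fun j => lincomb v (row j (row_base (U^C)%MS))); split=> [j|z Bz].
  exact: lincomb_closed.
have [a [Aa ua]] := hv _ Bz.
have : (a <= U + U^C)%MS by rewrite submx_full // addsmx_compl_full.
case/sub_addsmxP => -[a1 a2] /= Ea.
have : (a2 *m U^C <= row_base (U^C)%MS)%MS by rewrite eq_row_base submxMl.
case/submxP => b Eb; rewrite {}Eb in Ea.
have Yb : Y (z - lincomb v (b *m row_base (U^C)%MS)).
  have -> : z - lincomb v (b *m row_base (U^C)%MS) =
      (z - lincomb v a) + lincomb v (a1 *m U).
    by rewrite Ea lincombD opprD addrA addrAC subrK.
  by apply: YD; [exact: AY | apply/hU/submxMl].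
exists b; split; first by rewrite -/(lincomb _ b) -lincombM.
move=> c; rewrite -/(lincomb _ c) -lincombM => Yc.
apply: (row_free_inj (row_base_free _)).
apply/subr0_eq/eqP; rewrite -submx0 -(capmx_compl U) sub_capmx; apply/andP; split.
  apply/hU; rewrite lincombB.
  rewrite -[X in Y X](_ : (z - lincomb v (c *m row_base (U^C)%MS)) -
      (z - lincomb v (b *m row_base (U^C)%MS)) = _); first exact: subspaceB.
  by rewrite opprB addrC addrA subrK.
by rewrite -mulmxBl (submx_trans (submxMl _ _)) // eq_row_base.
Qed.

Variable W : lmodType S.

(** First isomorphism theorem: within [B], [Y] is the preimage of [A], so [f] identifies [B / Y]
    with [(f(B) + A) / A]. *)
Lemma dim_quot_image (f : {linear V -> W}) B Y (A : W -> Prop) r :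
  subspace B -> subspace A ->
  (forall b, B b -> (A (f b) <-> Y b)) -> dim_quot B Y r ->
  dim_quot (fun z => exists2 b, B b & A (z - f b)) A r.
Proof.
move=> sB sA fY [v [Bv hv]]; have [A0 AD AZ] := sA.
exists (fun j => f (v j)); split=> [j|z [b Bb Ab]].
  by exists (v j); rewrite ?subrr.
have key a : A (z - lincomb (fun j => f (v j)) a) <-> Y (b - lincomb v a).
  rewrite -fY; last by apply: subspaceB => //; apply: lincomb_closed.
  have -> : f (b - lincomb v a) = (z - lincomb (fun j => f (v j)) a) - (z - f b).
    by rewrite linearB lincomb_map opprB [RHS]addrC addrA subrK.
  split=> H; first exact: subspaceB.
  by rewrite -[z - lincomb _ a](subrK (z - f b)); apply: AD.
have [a [Ya ua]] := hv _ Bb; exists a; split; first exact/key.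
by move=> c Ac; apply/ua/key.
Qed.

Lemma dim_quot_rank_nullity (f : {linear V -> W}) B A (A' : W -> Prop) n :
  subspace B -> subspace A -> subspace A' ->
  (forall z, A z -> B z) -> (forall z, A z -> A' (f z)) -> dim_quot B A n ->
  exists k r, [/\ n = (k + r)%N, dim_quot (fun b => B b /\ A' (f b)) A k
    & dim_quot (fun z => exists2 b, B b & A' (z - f b)) A' r].
Proof.
move=> sB sA sA' AB AA' hn.
have sY : subspace (fun b => B b /\ A' (f b)).
  case: (sB) (sA') => B0 BD BZ [A0 AD AZ]; split.
  - by rewrite linear0.
  - by move=> u v [Bu Au] [Bv Av]; rewrite linearD; split; [apply: BD | apply: AD].
  - by move=> c u [Bu Au]; rewrite linearZ; split; [apply: BZ | apply: AZ].
have [||k [r [En hk hr]]] := @dim_quot_between A _ B n sA sY sB _ _ hn.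
- by move=> z Az; split; auto.
- by move=> z [].
exists k, r; split=> //; apply: (dim_quot_image sB sA' _ hr) => b Bb.
by split=> [|[]].
Qed.

Lemma dim_quot_preimage (f : {linear V -> W}) A B (A' B' : W -> Prop) k :
  (forall z, A' z -> exists y, z = f y) ->
  (forall z, A' (f z) <-> A z) -> (forall z, B' (f z) <-> B z) ->
  dim_quot A' B' k -> dim_quot A B k.
Proof.
move=> im eA eB [w [Aw hw]].
have /fin_all_exists [v hv] j : exists y, w j = f y by apply/im/Aw.
exists v; split=> [j|z /eA /hw [a [Ba ua]]]; first by apply/eA; rewrite -hv.
have E b : f (z - lincomb v b) = f z - lincomb w b.
  rewrite linearB lincomb_map; congr (_ - _).
  by apply: eq_bigr => j _; rewrite hv.
exists a; split=> [|b Bb]; first by apply/eB; rewrite E.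
by apply: ua; rewrite -[X in B' X](E b); apply/eB.
Qed.

End DimQuot.

(** * Supports, weights and the torus *)

Section Support.
Variables (K : comNzRingType) (d : nat).
Local Notation S := {mpoly K[d]}.
Implicit Types (P : pred 'X_{1..d}) (f g : S).

Definition supported P f : Prop := forall m, m \in msupp f -> P m.

Definition mrestrict P f : S := \sum_(m <- msupp f | P m) f@_m *: 'X_[m].

Lemma supported0 P : supported P 0.
Proof. by move=> m; rewrite msupp0. Qed.

Lemma supportedD P f g : supported P f -> supported P g -> supported P (f + g).
Proof.
by move=> Pf Pg m /msuppD_le; rewrite mem_cat => /orP[/Pf | /Pg].
Qed.

Lemma supportedZ P c f : supported P f -> supported P (c *: f).
Proof. by move=> Pf m /msuppZ_le /Pf. Qed.

Lemma supportedN P f : supported P f -> supported P (- f).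
Proof. by rewrite -scaleN1r; apply: supportedZ. Qed.

Lemma supported_sum P (T : Type) (s : seq T) (Q : pred T) (F : T -> S) :
  (forall t, Q t -> supported P (F t)) -> supported P (\sum_(t <- s | Q t) F t).
Proof. by move=> PF; apply: big_ind => //; [exact: supported0 | exact: supportedD]. Qed.

Lemma supportedX P m : P m -> supported P 'X_[m].
Proof. by move=> Pm m'; rewrite msuppX inE => /eqP ->. Qed.

Lemma supportedM P1 P2 P f g : supported P1 f -> supported P2 g ->
  (forall m1 m2, P1 m1 -> P2 m2 -> P (m1 + m2)%MM) -> supported P (f * g).
Proof.
by move=> P1f P2g P12 m /msuppM_le /allpairsP [[m1 m2] /= [/P1f ? /P2g ? ->]]; apply: P12.
Qed.

Lemma supported_sub P1 P2 f : (forall m, P1 m -> P2 m) -> supported P1 f -> supported P2 f.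
Proof. by move=> P12 P1f m /P1f/P12. Qed.

Lemma supported_disjoint P f : supported P f -> supported (predC P) f -> f = 0.
Proof.
move=> Pf nPf; apply/mpolyP => m; rewrite mcoeff0; apply/eqP; rewrite mcoeff_eq0.
by apply/negP => mf; have := nPf m mf; rewrite /= (Pf m mf).
Qed.

Lemma mcoeff_sum_monomials (s : seq 'X_{1..d}) P (c : 'X_{1..d} -> K) m : uniq s ->
  (\sum_(m' <- s | P m') c m' *: 'X_[m'])@_m = if (m \in s) && P m then c m else 0.
Proof.
move=> us; rewrite raddf_sum /=.
under eq_bigr => m' _ do rewrite mcoeffZ mcoeffX.
case: ifP => [/andP[ms Pm] | nms].
  rewrite big_mkcond (bigD1_seq m) //= Pm eqxx mulr1 big1 ?addr0 // => m' /negPf ->.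
  by rewrite mulr0 if_same.
rewrite big_seq_cond big1 // => m' /andP[m's Pm']; case: eqP => [e|]; last by rewrite mulr0.
by rewrite -e m's Pm' in nms.
Qed.

Lemma mcoeff_restrict P f m : (mrestrict P f)@_m = if P m then f@_m else 0.
Proof.
rewrite mcoeff_sum_monomials ?msupp_uniq //; case: (P m); rewrite ?andbF // andbT.
by case: ifPn => // /memN_msupp_eq0 ->.
Qed.

Lemma supported_restrict P f : supported P (mrestrict P f).
Proof.
by move=> m; rewrite mcoeff_msupp mcoeff_restrict; case: (P m); rewrite ?eqxx.
Qed.

Lemma supported_restrictC P f : supported (predC P) (f - mrestrict P f).
Proof.
move=> m; rewrite mcoeff_msupp mcoeffB mcoeff_restrict /=.
by case: (P m) => //; rewrite subrr eqxx.
Qed.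

Lemma supported_dvd m0 P f : supported P f -> supported (fun m => m0 <= m)%MM f ->
  exists2 g, f = 'X_[m0] * g & supported (fun m => P (m0 + m)%MM) g.
Proof.
move=> Pf df; exists (\sum_(m <- msupp f) f@_m *: 'X_[m - m0]).
  rewrite mulr_sumr [LHS]mpolyE big_seq [RHS]big_seq; apply: eq_bigr => m mf.
  by rewrite -scalerAr -mpolyXD addmC submK //; apply: df.
rewrite big_seq; apply: supported_sum => m mf; apply: supportedZ; apply: supportedX.
by rewrite addmC submK ?Pf ?df.
Qed.

Lemma mcoeffXM m0 f m : ('X_[m0] * f)@_m = if (m0 <= m)%MM then f@_(m - m0) else 0.
Proof.
rewrite mulrC; case: ifPn => [le|nle].
  by rewrite -{1}(submK le) addmC mcoeffMX.
apply: memN_msupp_eq0; apply: contra nle => /msuppM_le /allpairsP [[m1 m2] /= [_]].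
by rewrite msuppX inE => /eqP -> ->; rewrite lem_addl.
Qed.

End Support.

Section Weights.
Variable d : nat.
Implicit Types (v w : weight d) (m : 'X_{1..d}).

Definition mnm_weight m : weight d := [ffun i => (m i)%:Z].

(* [ffunE] leaves evaluations that [lia] does not identify with the original
   ones. *)
Lemma weightDE v w i : (v + w) i = v i + w i. Proof. exact: ffunE. Qed.
Lemma weightNE v i : (- v) i = - v i. Proof. exact: ffunE. Qed.
Lemma weight0E i : (0 : weight d) i = 0. Proof. exact: ffunE. Qed.
Lemma mnm_weightE m i : mnm_weight m i = (m i)%:Z. Proof. exact: ffunE. Qed.
Definition weightE := (weightDE, weightNE, weight0E, mnm_weightE).

(* The weights that restrict to the trivial character of the torus T. *)
Definition const_weight v : bool := [forall i, forall j, v i == v j].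

Lemma const_weightP v : reflect (forall i j, v i = v j) (const_weight v).
Proof.
apply: (iffP forallP) => [H i j|H i]; first by have /forallP/(_ j)/eqP := H i.
by apply/forallP => j; apply/eqP.
Qed.

Lemma const_weight0 : const_weight 0.
Proof. by apply/const_weightP => i j; rewrite !ffunE. Qed.

Lemma const_weightD v w : const_weight v -> const_weight w -> const_weight (v + w).
Proof.
move=> /const_weightP hv /const_weightP hw; apply/const_weightP => i j.
by rewrite !ffunE (hv i j) (hw i j).
Qed.

Lemma const_weightN v : const_weight (- v) = const_weight v.
Proof.
suff H u : const_weight u -> const_weight (- u).
  by apply/idP/idP => [/H|/H //]; rewrite opprK.
by move=> /const_weightP hu; apply/const_weightP => i j; rewrite !ffunE (hu i j).
Qed.

Lemma const_weightB v w : const_weight v -> const_weight w -> const_weight (v - w).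
Proof. by move=> hv hw; rewrite const_weightD ?const_weightN. Qed.

Lemma const_weightDl v w : const_weight v -> const_weight (v + w) = const_weight w.
Proof.
move=> hv; apply/idP/idP => [h|]; last exact: const_weightD.
by rewrite -[w](addKr v) const_weightD ?const_weightN.
Qed.

Lemma mnm_weightD m1 m2 : mnm_weight (m1 + m2) = mnm_weight m1 + mnm_weight m2.
Proof. by apply/ffunP => i; rewrite !ffunE mnmDE. Qed.

Lemma mnm_weight_inj : injective mnm_weight.
Proof. by move=> m1 m2 /ffunP e; apply/mnmP => i; have := e i; rewrite !ffunE => -[]. Qed.

Definition of_weight w : pred 'X_{1..d} := fun m => const_weight (mnm_weight m - w).

Lemma of_weightD v w m1 m2 : of_weight v m1 -> of_weight w m2 ->
  of_weight (v + w) (m1 + m2)%MM.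
Proof. by move=> h1 h2; rewrite /of_weight mnm_weightD opprD addrACA const_weightD. Qed.

End Weights.

Section TorusAction.
Variables (R : realType) (d : nat).
Local Notation C := (complex R).
Local Notation S := (Cpoly R d).
Implicit Types (t : 'I_d -> C) (f : S) (v w : weight d).

Lemma CY_torus_neq0 t i : CY_torus t -> t i != 0.
Proof.
move=> ht; have /prodf_neq0 : \prod_i t i != 0 by rewrite (ht : _ = _) oner_neq0.
exact.
Qed.

Lemma mcoeff_torus_act t f m : (torus_act t f)@_m = weight_val (mnm_weight m) t * f@_m.
Proof.
rewrite /torus_act comp_mpolyE.
under eq_bigr => m' _.
  under eq_bigr => i _ do rewrite tnth_mktuple exprZn.
  rewrite scaler_prod -mpolyXE_id scalerA.
over.
rewrite (mcoeff_sum_monomials predT) ?msupp_uniq // andbT mulrC.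
have -> : weight_val (mnm_weight m) t = \prod_i t i ^+ m i.
  by apply: eq_bigr => i _; rewrite ffunE.
by case: ifPn => // /memN_msupp_eq0 ->; rewrite mulr0.
Qed.

Lemma weight_valD v w t : CY_torus t -> weight_val (v + w) t = weight_val v t * weight_val w t.
Proof.
move=> ht; rewrite /weight_val -big_split; apply: eq_bigr => i _.
by rewrite ffunE expfzDr ?CY_torus_neq0.
Qed.

Lemma weight_val_const v t : CY_torus t -> const_weight v -> weight_val v t = 1.
Proof.
move=> ht /const_weightP hv.
case: d t v ht hv => [|e] t v ht hv; first by rewrite /weight_val big_ord0.
rewrite /weight_val; under eq_bigr => i _ do rewrite (hv i ord0).
have P k : \prod_i t i ^+ k = 1 by rewrite prodrXl (ht : _ = _) expr1n.
case: (v ord0) => k; first exact: P.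
by under eq_bigr => i _ do rewrite NegzE; rewrite prodfV P invr1.
Qed.

Lemma weight_val_neq0 v t : CY_torus t -> weight_val v t != 0.
Proof. by move=> ht; apply/prodf_neq0 => i _; rewrite expfz_neq0 ?CY_torus_neq0. Qed.

(** If [v i] and [v j] differ, the point with coordinates 2 at [i], 1/2 at [j] and 1 elsewhere takes
    the value 2^(v i - v j), which is not 1. *)
Lemma weight_val_separates v : ~~ const_weight v ->
  exists2 t : 'I_d -> C, CY_torus t & weight_val v t != 1.
Proof.
case/forallPn => i /forallPn [j vij].
have nij : j != i by apply: contra vij => /eqP ->.
pose t k : C := if k == i then 2 else if k == j then 2^-1 else 1.
have two0 : (2 : C) != 0 by rewrite pnatr_eq0.
have ti : t i = 2 by rewrite /t eqxx.
have tj : t j = 2^-1 by rewrite /t (negPf nij) eqxx.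
have tk k : k != i -> k != j -> t k = 1 by rewrite /t => /negPf -> /negPf ->.
exists t.
  rewrite /CY_torus (bigD1 i) //= (bigD1 j) //= big1 ?mulr1 => [|k /andP[? ?]].
    by rewrite ti tj divff.
  exact: tk.
rewrite /weight_val (bigD1 i) //= (bigD1 j) //= big1 ?mulr1 => [|k /andP[? ?]]; last first.
  by rewrite tk ?exp1rz.
rewrite ti tj exprz_inv -expfzDr //; case: (v i - v j) (subr_eq0 (v i) (v j)) => k.
  rewrite (negPf vij) => /negbT k0; rewrite pexprz_eq1 ?ler0n // (negPf k0).
  by rewrite (eqr_nat C 2 1).
move=> _; rewrite NegzE -invr_expz invr_eq1.
by rewrite pexprz_eq1 ?ler0n // (eqr_nat C 2 1).
Qed.

Lemma T_semi_invariantP w f : T_semi_invariant w f <-> supported (of_weight w) f.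
Proof.
split=> [hf m mf | hf t ht].
  apply/negPn/negP => /weight_val_separates [t ht] /eqP; apply.
  have /(congr1 (mcoeff m)) := hf t ht; rewrite mcoeff_torus_act mcoeffZ.
  move/mulIf; rewrite -mcoeff_msupp => /(_ mf) e.
  apply: (mulIf (weight_val_neq0 w ht)); rewrite -weight_valD // subrK mul1r.
  exact: e.
apply/mpolyP => m; rewrite mcoeff_torus_act mcoeffZ.
have [mf|/memN_msupp_eq0 ->] := boolP (m \in msupp f); last by rewrite !mulr0.
by rewrite -[mnm_weight m](subrK w) weight_valD // weight_val_const ?mul1r //; apply: hf.
Qed.

End TorusAction.

(** * Torus-fixed ideals are monomial *)

Definition mnm_ones d k : 'X_{1..d} := [multinom k | i < d].

(** Exponents of the same T-character differ by a multiple of (1, ..., 1), which the comparison of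
    degrees makes nonnegative. *)
Lemma of_weight_mnm d (m m' : 'X_{1..d}) : (0 < d)%N ->
  of_weight (mnm_weight m) m' -> (mdeg m <= mdeg m')%N ->
  exists k, m' = (m + mnm_ones d k)%MM.
Proof.
case: d m m' => // e m m' _ /const_weightP h le.
have E i j : (m' i + m j = m' j + m i)%N by have := h i j; rewrite !ffunE; lia.
have le0 : (m ord0 <= m' ord0)%N.
  rewrite leqNgt; apply/negP => lt0; move: le; rewrite leqNgt => /negP[].
  rewrite !mdegE !big_ord_recl -addSn leq_add //; apply: leq_sum => i _.
  by have := E (lift ord0 i) ord0; lia.
exists (m' ord0 - m ord0)%N; apply/mnmP => i; rewrite mnmDE mnmE.
by have := E i ord0; lia.
Qed.

Section TFixedIdeal.
Variables (R : realType) (d : nat) (I : Cpoly R d -> Prop).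
Local Notation C := (complex R).
Local Notation S := (Cpoly R d).
Hypothesis idealI : is_ideal I.
Implicit Types (f g : S) (m : 'X_{1..d}).

Let I0 : I 0. Proof. by case: idealI. Qed.
Let ID f g : I f -> I g -> I (f + g). Proof. by case: idealI => _ + _; apply. Qed.
Let IM a f : I f -> I (a * f). Proof. by case: idealI => _ _; apply. Qed.

Lemma idealZ c f : I f -> I (c *: f).
Proof. by move=> If; rewrite -mul_mpolyC; apply: IM. Qed.

Lemma idealB f g : I f -> I g -> I (f - g).
Proof. by move=> If Ig; rewrite -scaleN1r; apply/ID/idealZ. Qed.

Lemma ideal_sum (T : Type) (s : seq T) (P : pred T) (F : T -> S) :
  (forall t, P t -> I (F t)) -> I (\sum_(t <- s | P t) F t).
Proof. by move=> PF; apply: (big_ind I). Qed.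

Lemma ideal_subspace : subspace (V := S^o) I.
Proof. by split=> // c u; apply: IM. Qed.

Hypothesis TI : forall (t : 'I_d -> C) f, CY_torus t -> I f -> I (torus_act t f).

(** Induction on the number of monomials of [f] outside the weight [w]: a torus element separating
    such a monomial from [w] eliminates it without leaving the ideal. *)
Lemma ideal_component w f : I f -> I (mrestrict (of_weight w) f).
Proof.
have [k] := ubnP (size [seq m <- msupp f | ~~ of_weight w m]).
elim: k f => // k IH f lek If.
have [/hasP [m mf mw]|/hasPn hw] := boolP (has (predC (of_weight w)) (msupp f)); last first.
  suff -> : mrestrict (of_weight w) f = f by [].
  apply/mpolyP => m; rewrite mcoeff_restrict; case: ifP => // mw.
  by apply/esym/memN_msupp_eq0; apply/negP => /hw /=; rewrite mw.
have [t ht tm] := weight_val_separates R mw.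
have tm' : weight_val (mnm_weight m) t != weight_val w t.
  apply: contra tm => /eqP e; apply/eqP/(mulIf (weight_val_neq0 w ht)).
  by rewrite -weight_valD // subrK mul1r.
(* The combination [g] loses the monomial [m], and [c] is normalized so that the component of weight
   [w] is unchanged. *)
pose c := (weight_val w t - weight_val (mnm_weight m) t)^-1.
pose g := c *: (torus_act t f - weight_val (mnm_weight m) t *: f).
have gE m' : g@_m' = c * (weight_val (mnm_weight m') t - weight_val (mnm_weight m) t) * f@_m'.
  by rewrite mcoeffZ mcoeffB mcoeff_torus_act mcoeffZ -mulrBl mulrA.
have Ig : I g by apply/idealZ/idealB; [exact: TI | exact: idealZ].
have -> : mrestrict (of_weight w) f = mrestrict (of_weight w) g.
  apply/mpolyP => m'; rewrite !mcoeff_restrict; case: ifP => // m'w.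
  rewrite gE -[mnm_weight m'](subrK w) weight_valD // (weight_val_const ht m'w).
  by rewrite mul1r mulVf ?mul1r // subr_eq0 eq_sym.
apply: IH Ig; rewrite -ltnS; apply: leq_trans lek; rewrite ltnS.
have sub : {subset m :: [seq m' <- msupp g | ~~ of_weight w m'] <=
            [seq m' <- msupp f | ~~ of_weight w m']}.
  move=> m'; rewrite inE => /orP[/eqP ->|]; rewrite !mem_filter; first by rewrite mf andbT.
  case/andP => -> /=; rewrite !mcoeff_msupp gE; apply: contra => /eqP ->.
  by rewrite mulr0.
apply: leq_trans (uniq_leq_size _ sub) => //=.
rewrite filter_uniq ?msupp_uniq // andbT mem_filter negb_and mcoeff_msupp gE.
by rewrite subrr mulr0 mul0r eqxx orbT.
Qed.

Variable n : nat.
Hypothesis codimI : dim_quot (V := S^o) (fun=> True) I n.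
Hypothesis d2 : (1 < d)%N.

(** The powers of [x_i] with exponents 0 to [n] are dependent modulo [I]. In the presence of a
    second variable they have distinct T-characters, so a weight component of the relation is a
    multiple of a single power. *)
Lemma ideal_variable_power i : exists k, I 'X_[U_(i) *+ k].
Proof.
pose v (k : 'I_n.+1) : S^o := 'X_[U_(i) *+ k].
have [//|c c0 Ic] := dim_quot_dependent (v := v) ideal_subspace codimI _ (ltnSn n).
have [k ck] : exists k, c 0 k != 0 by apply/rV0Pn.
exists k; have := ideal_component (mnm_weight (U_(i) *+ k)) Ic.
suff -> : mrestrict (of_weight (mnm_weight (U_(i) *+ k))) (lincomb v c) = c 0 k *: 'X_[U_(i) *+ k].
  by move/(idealZ (c 0 k)^-1); rewrite scalerA mulVf // scale1r.
have vE m : (lincomb v c : S)@_m = \sum_j c 0 j * ('X_[U_(i) *+ j] : S)@_m.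
  rewrite /lincomb raddf_sum; apply: eq_bigr => j _.
  by rewrite /= -[_ *: _]/(_ * _) mcoeffCM.
apply/mpolyP => m; rewrite mcoeff_restrict vE mcoeffZ.
have [j nji] : exists j : 'I_d, j != i.
  have : (0 < #|predC1 i|)%N by rewrite cardC1 card_ord; case: d d2 => [|[]].
  by case/card_gt0P => j; exists j.
rewrite (bigD1 k) //=; case: ifP => [mk|nmk].
  rewrite big1 ?addr0 // => l nlk; rewrite mcoeffX; case: eqP => [e|]; last by rewrite mulr0.
  move: mk nlk; rewrite -e => /const_weightP/(_ i j).
  rewrite !ffunE !mulmnE !mnm1E eqxx eq_sym (negPf nji) => h.
  by case/eqP; apply: val_inj => /=; move: h => /=; lia.
rewrite mcoeffX; case: eqP => [e|]; last by rewrite mulr0.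
by move: nmk; rewrite -e /of_weight subrr const_weight0.
Qed.

Lemma ideal_mnmD m m' : I 'X_[m] -> I 'X_[(m + m')%MM].
Proof. by rewrite addmC mpolyXD; apply: IM. Qed.

Lemma ideal_mnm_le m m' : (m <= m')%MM -> I 'X_[m] -> I 'X_[m'].
Proof. by move=> /submK <-; rewrite addmC; apply: ideal_mnmD. Qed.

(** A weight component mixes monomials that differ by multiples of (1, ..., 1). If some lie outside
    [I], drop those in [I] and let [m1] be the lowest exponent left. Multiplying by a power of the
    product of all variables brings [m1] into [I]; one step before the least such power, every other
    term is already in [I], hence so is the lowest one, a contradiction. *)
Lemma ideal_monomial f m : I f -> m \in msupp f -> I 'X_[m].
Proof.
move=> If mf; apply: contrapT => nIm; pose J m := `[< I 'X_[m] >].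
pose f1 := mrestrict (predC J) (mrestrict (of_weight (mnm_weight m)) f).
have f1E m' : f1@_m' = if ~~ J m' && of_weight (mnm_weight m) m' then f@_m' else 0.
  by rewrite !mcoeff_restrict /=; case: (J m').
have If1 : I f1.
  set g := mrestrict (of_weight _) f in f1 f1E *.
  have -> : f1 = g - mrestrict J g.
    apply/mpolyP => m'; rewrite mcoeffB !mcoeff_restrict /=.
    by case: (J m'); rewrite ?subrr ?subr0.
  apply: idealB; first exact: ideal_component.
  by apply: ideal_sum => m' /asboolP Im'; apply: idealZ.
have mf1 : m \in msupp f1.
  rewrite mcoeff_msupp f1E /of_weight subrr const_weight0 andbT.
  by rewrite ifT -?mcoeff_msupp //; apply/negP => /asboolP.
have [|k /hasP [m1 m1f /eqP m1k] mink] := @ex_minnP (fun k => has (fun m' => mdeg m' == k) (msupp f1)).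
  by exists (mdeg m); apply/hasP; exists m.
have Pf1 m' : m' \in msupp f1 -> ~~ J m' /\ of_weight (mnm_weight m) m'.
  rewrite mcoeff_msupp f1E; by case: ifP => [/andP[]|]; rewrite ?eqxx.
have [nJ1 w1] := Pf1 _ m1f.
have i0 : 'I_d by exists 0%N; lia.
have [M IM0] := ideal_variable_power i0.
have exj : exists j, J (m1 + mnm_ones d j)%MM.
  exists M; apply/asboolP; rewrite addmC; apply: ideal_mnmD.
  apply: ideal_mnm_le IM0; apply/mnm_lepP => i; rewrite mulmnE mnm1E mnmE.
  by case: eqP => _; rewrite ?mul1n ?mul0n.
case: (ex_minnP exj) => -[|j] Jj minj.
  by move: nJ1; rewrite -[m1]addm0 (_ : 0%MM = mnm_ones d 0) ?Jj //; apply/mnmP => i; rewrite !mnmE.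
suff : J (m1 + mnm_ones d j)%MM by move/minj; rewrite ltnn.
apply/asboolP.
have := IM 'X_[mnm_ones d j] If1.
rewrite [f1 in _ * f1]mpolyE (bigD1_seq m1) ?msupp_uniq //= mulrDr => H.
suff : I (f1@_m1 *: 'X_[(m1 + mnm_ones d j)%MM]).
  by move/(idealZ (f1@_m1)^-1); rewrite scalerA mulVf -?mcoeff_msupp // scale1r.
have -> : f1@_m1 *: 'X_[(m1 + mnm_ones d j)%MM] = 'X_[mnm_ones d j] * (f1@_m1 *: 'X_[m1]).
  by rewrite -scalerAr -mpolyXD addmC.
rewrite -[X in I X](addrK ('X_[mnm_ones d j] * \sum_(m' <- msupp f1 | m' != m1) f1@_m' *: 'X_[m'])).
apply: idealB => //; rewrite mulr_sumr big_seq_cond; apply: ideal_sum => m' /andP[m'f m'1].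
rewrite -scalerAr -mpolyXD; apply: idealZ.
have [nJ' w'] := Pf1 _ m'f.
have [|||[|k'] E] := @of_weight_mnm _ m1 m'; first by lia.
- rewrite /of_weight -[mnm_weight m'](subrK (mnm_weight m)) -addrA const_weightD //.
  by rewrite -const_weightN opprB.
- by rewrite m1k; apply: mink; apply/hasP; exists m'.
- by move: m'1; rewrite E (_ : mnm_ones d 0 = 0%MM) ?addm0 ?eqxx //; apply/mnmP => i; rewrite !mnmE.
(* The other exponents exceed [m1] by at least one copy of (1, ..., 1), so [j] further copies reach
   the threshold [j.+1]. *)
move/asboolP: Jj; apply: ideal_mnm_le; apply/mnm_lepP => i.
by rewrite E !mnmDE !mnmE; lia.
Qed.

End TFixedIdeal.

(* [J] is the set of exponents of the monomials of a monomial ideal of finite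
   colength, and [boxes] the finite set of the remaining exponents. *)
Record monomial_ideal d (J : pred 'X_{1..d}) (boxes : seq 'X_{1..d}) (M : nat) : Prop := {
  mi_up : forall m m', J m -> J (m + m')%MM;
  mi_uniq : uniq boxes;
  mi_box : forall m, (m \in boxes) = ~~ J m;
  mi_power : forall i, J (U_(i) *+ M)%MM
}.

Lemma T_fixed_monomial (R : realType) d n (I : Cpoly R d -> Prop) :
  (1 < d)%N -> T_fixed_point n I ->
  exists J boxes M, monomial_ideal J boxes M /\ forall f, I f <-> supported J f.
Proof.
move=> d2 [idI codimI TI].
pose J m := `[< I 'X_[m] >].
have upJ m m' : J m -> J (m + m')%MM.
  by move=> /asboolP H; apply/asboolP; apply: (ideal_mnmD idI).
have /fin_all_exists [M hM] : forall i, exists k, I 'X_[U_(i) *+ k].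
  by move=> i; apply: (ideal_variable_power idI TI codimI d2).
pose B := \max_i M i.
have JB i : J (U_(i) *+ B)%MM.
  have /submK <- : (U_(i) *+ M i <= U_(i) *+ B)%MM.
    apply/mnm_lepP => j; rewrite !mulmnE leq_mul2l.
    by rewrite [X in _ || X](leq_bigmax i) orbT.
  by rewrite addmC; apply/upJ/asboolP.
(* The powers [x_i^B] in the ideal confine the remaining exponents to degree at most [d * B], where
   they can be enumerated. *)
pose boxes := [seq val m | m <- enum {: 'X_{1..d < (d * B).+1}} & ~~ J (val m)].
exists J, boxes, B; split; last first.
  move=> f; split=> [If m mf | Jf].
    by apply/asboolP; apply: (ideal_monomial idI TI codimI d2 If mf).
  rewrite [f]mpolyE big_seq; apply: ideal_sum => // m mf; apply: idealZ => //.
  exact/asboolP/Jf.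
split=> // [|m].
  rewrite map_inj_uniq; [by apply: filter_uniq; apply: enum_uniq | by move=> ? ?; apply: val_inj].
apply/mapP/idP => [[m'] + ->|nJ]; first by rewrite mem_filter => /andP[].
have mB i : (m i < B)%N.
  rewrite ltnNge; apply: contra nJ => le.
  have /submK <- : (U_(i) *+ B <= m)%MM.
    apply/mnm_lepP => j; rewrite mulmnE mnm1E.
    by case: eqP => [<-|_]; rewrite ?mul1n ?mul0n.
  by rewrite addmC; apply: upJ.
have lt : (mdeg m < (d * B).+1)%N.
  rewrite ltnS mdegE -[d in (d * B)%N]card_ord -sum_nat_const.
  by apply: leq_sum => i _; apply: ltnW.
by exists (BMultinom lt); rewrite // mem_filter nJ mem_enum.
Qed.

(** * Counting monomials *)

Section LocalCohomologyCount.
Variable e : nat.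
Local Notation d := e.+2.
Implicit Types (v w : weight d) (m : 'X_{1..d}).

(** A translate [v + k (1, ..., 1)] is nonnegative outside [x_0] when [k >= - tail_min v], and
    negative at [x_0] when [k < - v ord0]; counting such [k] gives [neg_count]. *)
Definition tail_min v : int :=
  v (lift ord0 (Order.arg_min (ord0 : 'I_e.+1) xpredT (fun j => v (lift ord0 j)))).

(* The number of monomials with exponent congruent to [v] modulo (1, ..., 1) in
   the local cohomology module S[1/x_0] / S. *)
Definition neg_count v : nat := absz (Num.max 0 (tail_min v - v ord0)).

Lemma tail_minP v : exists2 i, i != ord0 & tail_min v = v i.
Proof. by rewrite /tail_min; case: Order.TotalTheory.arg_minP => // j _ _; exists (lift ord0 j). Qed.

Lemma tail_min_le v i : i != ord0 -> tail_min v <= v i.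
Proof.
rewrite /tail_min; case: Order.TotalTheory.arg_minP => // j _ minj; case: (unliftP ord0 i) => [k -> _|->].
  exact: minj.
by rewrite eqxx.
Qed.

Lemma neg_countE v : (neg_count v)%:Z = Num.max 0 (tail_min v - v ord0).
Proof. by rewrite /neg_count gez0_abs // le_max lexx. Qed.

Lemma tail_min_eq v (c : int) :
  (exists2 i, i != ord0 & v i = c) -> (forall i, i != ord0 -> c <= v i) -> tail_min v = c.
Proof.
move=> [i ni vi] le; apply/le_anti/andP; split; first by rewrite -vi tail_min_le.
by have [j nj ->] := tail_minP v; apply: le.
Qed.

Lemma neg_count_const v w : const_weight (v - w) -> neg_count v = neg_count w.
Proof.
move=> /const_weightP h.
have E i : v i = w i + (v ord0 - w ord0) by have := h i ord0; rewrite !weightE; lia.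
have tE : tail_min v = tail_min w + (v ord0 - w ord0).
  apply: tail_min_eq => [|i ni]; last by rewrite (E i) lerD2r tail_min_le.
  by have [i ni ->] := tail_minP w; exists i => //; rewrite (E i).
by rewrite /neg_count tE; congr (absz (Num.max 0 _)); lia.
Qed.

Lemma neg_count0 : neg_count 0 = 0%N.
Proof. by have [i _ E] := tail_minP 0; rewrite /neg_count E !weightE. Qed.

Definition x0_power N : 'X_{1..d} := (U_(ord0) *+ N)%MM.

Lemma x0_powerE N i : x0_power N i = if i == ord0 then N else 0%N.
Proof. by rewrite mulmnE mnm1E eq_sym; case: eqP => _; rewrite ?mul1n ?mul0n. Qed.

Lemma x0_power_le N m : (x0_power N <= m)%MM = (N <= m ord0)%N.
Proof.
apply/mnm_lepP/idP => [/(_ ord0)|le i]; first by rewrite x0_powerE.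
by rewrite x0_powerE; case: eqP => [->|].
Qed.

(** Elements of weight [w] in S[1/x_0] have poles of order at most [neg_count w]. Each weight space
    of the localization can therefore be modelled inside S, multiplied by a large power of [x_0]. *)
Lemma of_weight_x0_power w N m : of_weight (w + mnm_weight (x0_power N)) m ->
  (N <= m ord0 + neg_count w)%N.
Proof.
move=> /const_weightP h; have [i ni E] := tail_minP w.
have := h i ord0; rewrite !weightE !x0_powerE (negPf ni) eqxx.
by have := neg_countE w; rewrite E; lia.
Qed.

Variables (J : pred 'X_{1..d}) (boxes : seq 'X_{1..d}) (M : nat).
Hypothesis JP : monomial_ideal J boxes M.

(* The number of monomials with exponent congruent to [v] modulo (1, ..., 1) in
   S[1/x_0] / I. *)
Definition quot_count v : nat := (neg_count v + count (of_weight v) boxes)%N.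

Lemma quot_count_const v w : const_weight (v - w) -> quot_count v = quot_count w.
Proof.
move=> h; rewrite /quot_count (neg_count_const h); congr (_ + _)%N.
apply: eq_count => m; rewrite /of_weight.
by rewrite -(const_weightDl (mnm_weight m - v) h) [_ + (_ - v)]addrC addrA subrK.
Qed.

(** The representative of [w] whose least exponent outside [x_0] is [l], multiplied by [x_0^N]. For
    [N >= neg_count w] the entries are nonnegative and [absz] changes nothing. *)
Definition neg_mnm w (N l : nat) : 'X_{1..d} :=
  [multinom absz ((w + mnm_weight (x0_power N))%R i - tail_min w + l%:Z)%R | i < d].

Lemma neg_mnmE w N l i : (neg_count w <= N)%N ->
  (neg_mnm w N l i)%:Z = (w + mnm_weight (x0_power N)) i - tail_min w + l%:Z.
Proof.
move=> le; rewrite mnmE gez0_abs // !weightE x0_powerE.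
have := neg_countE w; case: eqP => [-> | /eqP ni]; first by lia.
by have := tail_min_le w ni; lia.
Qed.

Definition quot_mnms w N : seq 'X_{1..d} :=
  [seq neg_mnm w N l | l <- iota 0 (neg_count w)] ++
  [seq (x0_power N + p)%MM | p <- boxes & of_weight w p].

Definition shifted_ideal N : pred 'X_{1..d} :=
  fun m => (x0_power N <= m)%MM && J (m - x0_power N)%MM.

Lemma size_quot_mnms w N : size (quot_mnms w N) = quot_count w.
Proof. by rewrite size_cat !size_map size_iota size_filter. Qed.

Lemma neg_mnm_lt w N l : (neg_count w <= N)%N -> (l < neg_count w)%N ->
  (neg_mnm w N l ord0 < N)%N.
Proof.
move=> le lt; have := neg_mnmE l ord0 le; have := neg_countE w.
by rewrite !weightE x0_powerE eqxx; lia.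
Qed.

(** After multiplication by [x_0^N], the monomials with a pole are those of exponent below [N] in
    [x_0], and the remaining ones outside [x_0^N I] come from boxes. Thus [quot_mnms] is a monomial
    basis of the weight space of S[1/x_0] / I. *)
Lemma mem_quot_mnms w N m : (neg_count w <= N)%N ->
  (m \in quot_mnms w N) =
  of_weight (w + mnm_weight (x0_power N)) m && ~~ shifted_ideal N m.
Proof.
move=> le; rewrite mem_cat /shifted_ideal x0_power_le; apply/orP/andP.
  case=> [/mapP [l] | /mapP [p]].
    rewrite mem_iota add0n /= => lt ->; rewrite leqNgt neg_mnm_lt //; split=> //.
    apply/const_weightP => i j.
    by have := neg_mnmE l i le; have := neg_mnmE l j le; rewrite !weightE; lia.
  rewrite mem_filter (mi_box JP) => /andP[wp nJ] ->.
  rewrite [X in J X](_ : _ = p) ?negb_and ?nJ ?orbT; last by rewrite addmC addmK.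
  by rewrite addmC of_weightD // /of_weight subrr const_weight0.
case=> wm; rewrite negb_and -ltnNge; case: ltnP => [lt _ | ge /= nJ]; last first.
  right; apply/mapP; exists (m - x0_power N)%MM; last by rewrite addmC submK ?x0_power_le.
  rewrite mem_filter (mi_box JP) nJ andbT /of_weight.
  by move: wm; rewrite -{1}[m](submK (m := x0_power N)) ?x0_power_le //
    /of_weight mnm_weightD opprD addrACA subrr addr0.
left; apply/mapP; exists (m ord0 + neg_count w - N)%N.
  by rewrite mem_iota; have := of_weight_x0_power wm; lia.
apply: mnm_weight_inj; apply/ffunP => i; rewrite !weightE neg_mnmE // !weightE.
have := of_weight_x0_power wm; move/const_weightP: wm => /(_ i ord0).
rewrite !weightE !x0_powerE eqxx; have := neg_countE w; case: eqP => [->|]; lia.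
Qed.

Lemma quot_mnms_uniq w N : (neg_count w <= N)%N -> uniq (quot_mnms w N).
Proof.
move=> le; rewrite cat_uniq; apply/and3P; split.
- rewrite map_inj_in_uniq ?iota_uniq // => l l' _ _ /(congr1 (fun m : 'X_{1..d} => m ord0)) E.
  by have := neg_mnmE l ord0 le; have := neg_mnmE l' ord0 le; rewrite E; lia.
- apply/hasPn => _ /mapP [p _ ->]; apply/mapP => -[l].
  rewrite mem_iota add0n /= => lt /(congr1 (fun m : 'X_{1..d} => m ord0)).
  by have := neg_mnm_lt le lt; rewrite mnmDE x0_powerE eqxx; lia.
rewrite map_inj_uniq ?filter_uniq ?(mi_uniq JP) // => p p'; exact: addmI.
Qed.

End LocalCohomologyCount.

Arguments neg_count {e} v%_ring_scope.
Arguments quot_count {e} boxes v%_ring_scope.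

(** * Weight spaces of equivariant matrices *)

Lemma big_tagged (V : nmodType) (I : finType) (J : I -> finType) (F : {i : I & J i} -> V) :
  \sum_t F t = \sum_i \sum_(j : J i) F (Tagged J j).
Proof.
rewrite (sig_big_dep xpredT (fun _ => xpredT) (fun i j => F (Tagged J j))) /=.
by apply: eq_bigr => -[].
Qed.

Section GradedMatrices.
Variables (R : realType) (d : nat).
Local Notation C := (complex R).
Local Notation S := (Cpoly R d).

(* The matrices of the T-equivariant homomorphisms between free modules whose
   basis vectors have weights [a] and [b]. *)
Definition graded_mx m n (a : 'I_m -> weight d) (b : 'I_n -> weight d)
  (A : 'M[S]_(m, n)) : Prop := forall i j, supported (of_weight (a i - b j)) (A i j).

Definition entries_in m n (P : pred 'X_{1..d}) (A : 'M[S]_(m, n)) : Prop :=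
  forall i j, supported P (A i j).

Lemma graded_mx_subspace m n a b : subspace (@graded_mx m n a b).
Proof.
split=> [i j|A B hA hB i j|c A hA i j]; first by rewrite mxE; apply: supported0.
  by rewrite mxE; apply: supportedD; [apply: hA | apply: hB].
by rewrite mxE mul_mpolyC; apply: supportedZ; apply: hA.
Qed.

Lemma entries_in_subspace m n P : subspace (@entries_in m n P).
Proof.
split=> [i j|A B hA hB i j|c A hA i j]; first by rewrite mxE; apply: supported0.
  by rewrite mxE; apply: supportedD; [apply: hA | apply: hB].
by rewrite mxE mul_mpolyC; apply: supportedZ; apply: hA.
Qed.

Lemma subspaceI (V : lmodType S) (P Q : V -> Prop) :
  subspace P -> subspace Q -> subspace (fun v => P v /\ Q v).
Proof.
move=> [P0 PD PZ] [Q0 QD QZ]; split=> // [u v [Pu Qu] [Pv Qv]|c u [Pu Qu]].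
  by split; [apply: PD | apply: QD].
by split; [apply: PZ | apply: QZ].
Qed.

Lemma graded_mx_mul m n p a b c (A : 'M[S]_(m, n)) (B : 'M[S]_(n, p)) :
  graded_mx a b A -> graded_mx b c B -> graded_mx a c (A *m B).
Proof.
move=> hA hB i k; rewrite mxE; apply: supported_sum => j _.
apply: supportedM (hA i j) (hB j k) _ => m1 m2 h1 h2.
by rewrite -[a i](subrK (b j)) -addrA; apply: of_weightD.
Qed.

(** The elementary matrices multiplied by the monomials of [L i j] form a basis: the coefficients at
    these monomials are the coordinates, and any other monomial of a graded matrix satisfies [P]. *)
Lemma dim_quot_graded_mx m n (a : 'I_m -> weight d) (b : 'I_n -> weight d)
    (P : pred 'X_{1..d}) (L : 'I_m -> 'I_n -> seq 'X_{1..d}) :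
  (forall i j, uniq (L i j)) ->
  (forall i j m', (m' \in L i j) = of_weight (a i - b j) m' && ~~ P m') ->
  dim_quot (graded_mx a b) (fun A => graded_mx a b A /\ entries_in P A)
    (\sum_i \sum_j size (L i j)).
Proof.
move=> uL memL.
pose T := {ij : 'I_m * 'I_n & 'I_(size (L ij.1 ij.2))}.
pose tg ij (l : 'I_(size (L ij.1 ij.2))) : T := Tagged (fun ij => 'I_(size (L ij.1 ij.2))) l.
pose mon (t : T) : 'X_{1..d} := nth 0%MM (L (tag t).1 (tag t).2) (tagged t).
pose v (t : T) : 'M[S]_(m, n) := 'X_[mon t] *: delta_mx (tag t).1 (tag t).2.
have monP t : of_weight (a (tag t).1 - b (tag t).2) (mon t) && ~~ P (mon t).
  by rewrite -memL mem_nth.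
have -> : (\sum_i \sum_j size (L i j))%N = #|{: T}|.
  rewrite pair_big /= card_tagged sumnE big_map big_enum.
  by apply: eq_bigr => ij _; rewrite card_ord.
have entry (c : T -> C) i j : (\sum_t (c t)%:MP *: v t) i j =
    \sum_(l < size (L i j)) c (tg (i, j) l) *:
      'X_[nth 0%MM (L i j) l].
  rewrite summxE big_tagged /=.
  rewrite (bigD1 (i, j)) //= [X in _ + X]big1 ?addr0 => [|ij nij].
    by apply: eq_bigr => l _; rewrite !mxE /= !eqxx mulr1 mul_mpolyC.
  rewrite big1 // => l _; rewrite !mxE /=.
  case: ij nij l => i' j' nij l /=; rewrite (_ : (i == i') && (j == j') = false) ?mulr0 //.
  by apply/negP => /andP[/eqP ei /eqP ej]; case/eqP: nij; rewrite ei ej.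
apply: (@dim_quotP _ _ _ _ _ _ v).
- by apply: subspaceI; [apply: graded_mx_subspace | apply: entries_in_subspace].
- move=> t i j; rewrite !mxE; case: (i =P _) => [->|_]; case: (j =P _) => [->|_] /=;
    rewrite ?mulr0 ?mulr1; try exact: supported0.
  by apply: supportedX; have /andP[] := monP t.
- move=> z hz; exists (fun t => (z (tag t).1 (tag t).2)@_(mon t)).
  have gz : graded_mx a b (\sum_t ((z (tag t).1 (tag t).2)@_(mon t))%:MP *: v t).
    apply: subspace_sum; first by apply: graded_mx_subspace.
    have [_ _ gZ] := @graded_mx_subspace m n a b.
    move=> t _; apply: gZ => i j.
    rewrite !mxE; case: (i =P _) => [->|_]; case: (j =P _) => [->|_] /=;
      rewrite ?mulr0 ?mulr1; try exact: supported0.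
    by apply: supportedX; have /andP[] := monP t.
  split; first by apply: subspaceB hz gz; apply: graded_mx_subspace.
  move=> i j m'; rewrite !mxE entry mcoeff_msupp mcoeffB.
  rewrite -(big_mkord xpredT (fun l => (z i j)@_(nth 0%MM (L i j) l) *: 'X_[nth 0%MM (L i j) l])).
  rewrite -(big_nth _ xpredT (fun m0 => (z i j)@_m0 *: 'X_[m0])).
  rewrite mcoeff_sum_monomials // andbT memL.
  have [m'z|/memN_msupp_eq0 ->] := boolP (m' \in msupp (z i j)); last by rewrite if_same subrr eqxx.
  by rewrite (hz i j m') //=; case: (P m') => //; rewrite subrr eqxx.
move=> c [_ hP] [[i j] l].
have := hP i j (nth 0%MM (L i j) l); rewrite entry mcoeff_msupp raddf_sum /=.
under eq_bigr => l' _ do rewrite mcoeffZ mcoeffX.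
rewrite (bigD1 l) //= eqxx mulr1 big1 ?addr0 => [|l' nl]; last first.
  by rewrite nth_uniq // (negPf nl : (l' == l :> nat) = false) mulr0.
have : nth 0%MM (L i j) l \in L i j by rewrite mem_nth.
rewrite memL => /andP[_ /negPf ->]; case: eqP => // _ /(_ isT); done.
Qed.

End GradedMatrices.

(** * Lifting along resolutions *)

Section GradedLift.
Variables (R : realType) (d : nat).
Local Notation S := (Cpoly R d).

Lemma graded_mxB m n (a : 'I_m -> weight d) (b : 'I_n -> weight d) (A B : 'M[S]_(m, n)) :
  graded_mx a b A -> graded_mx a b B -> graded_mx a b (A - B).
Proof. by move=> gA gB; apply: subspaceB gA gB; apply: graded_mx_subspace. Qed.

Lemma graded_lift m n p (a : 'I_m -> weight d) (b : 'I_n -> weight d)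
    (c : 'I_p -> weight d) (A : 'M[S]_(m, n)) (v : 'M[S]_(p, n)) :
  graded_mx a b A -> graded_mx c b v -> (exists u, v = u *m A) ->
  exists2 u, graded_mx c a u & v = u *m A.
Proof.
move=> gA gv [u vE].
pose u' := \matrix_(i, j) mrestrict (of_weight (c i - a j)) (u i j).
have gu' : graded_mx c a u' by move=> i j; rewrite mxE; apply: supported_restrict.
exists u'; first exact: gu'.
apply/eqP; rewrite -subr_eq0; apply/eqP/matrixP => i k.
rewrite [RHS]mxE.
apply: (@supported_disjoint _ _ (of_weight (c i - b k))).
  rewrite mxE; apply: supportedD; first exact: gv.
  by rewrite mxE; apply: supportedN; apply: (graded_mx_mul gu' gA).
rewrite vE -mulmxBl mxE; apply: supported_sum => j _.
have := @supported_restrictC _ _ (of_weight (c i - a j)) (u i j).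
rewrite !mxE => /supportedM /(_ (gA j k)); apply=> m1 m2 /= h1 h2.
apply: contra h1; rewrite /of_weight mnm_weightD => h.
have := const_weightB h h2; congr (const_weight _).
by apply/ffunP => l; rewrite !weightE; lia.
Qed.

Lemma graded_exact_lift m n q p (a : 'I_m -> weight d) (b : 'I_n -> weight d)
    (c : 'I_p -> weight d) (A : 'M[S]_(m, n)) (B : 'M[S]_(n, q)) (v : 'M[S]_(p, n)) :
  (forall w : 'rV_n, w *m B = 0 -> exists u, w = u *m A) ->
  graded_mx a b A -> graded_mx c b v -> v *m B = 0 ->
  exists2 u, graded_mx c a u & v = u *m A.
Proof.
move=> ex gA gv vB; apply: graded_lift gA gv _.
have /fin_all_exists [u hu] : forall i, exists w, row i v = w *m A.
  by move=> i; apply: ex; rewrite -row_mul vB row0.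
by exists (\matrix_i u i); apply/row_matrixP => i; rewrite row_mul rowK.
Qed.

End GradedLift.

Section NullHomotopy.
Variables (R : realType) (d : nat).
Local Notation S := (Cpoly R d).
Variables (rk : nat -> nat) (wt : forall i, 'I_(rk i) -> weight d).
Variables (D : forall i, 'M[S]_(rk i.+1, rk i)) (aug : 'cV[S]_(rk 0)).
Hypothesis gD : forall i, graded_mx (@wt i.+1) (@wt i) (D i).
Hypothesis gaug : graded_mx (@wt 0) (fun _ => 0) aug.
Hypothesis exact0 : forall v : 'rV_(rk 0),
  v *m aug = 0 <-> exists u : 'rV_(rk 1), v = u *m D 0.
Hypothesis exactS : forall i (v : 'rV_(rk i.+1)),
  v *m D i = 0 <-> exists u : 'rV_(rk i.+2), v = u *m D i.+1.

Lemma diff_diff i : D i.+1 *m D i = 0.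
Proof.
apply/row_matrixP => j; rewrite row_mul row0; apply/exactS.
by exists (delta_mx 0 j); rewrite -rowE.
Qed.

Lemma diff_aug : D 0 *m aug = 0.
Proof.
apply/row_matrixP => j; rewrite row_mul row0; apply/exact0.
by exists (delta_mx 0 j); rewrite -rowE.
Qed.

Variables (f : S) (wf : weight d) (sigma : 'rV[S]_(rk 0)).
Hypothesis gsigma : graded_mx (fun _ => wf) (@wt 0) sigma.
Hypothesis gf : supported (of_weight wf) f.
Hypothesis sigma_aug : sigma *m aug = f%:M.

Let gfM i : graded_mx (fun j => @wt i j + wf) (@wt i) (f%:M).
Proof.
move=> j k; rewrite mxE; case: eqP => [->|_]; last exact: supported0.
by rewrite mulr1n addrAC subrr add0r.
Qed.

(** Multiplication by an element [f] of the image of [aug] is zero on the cokernel of [aug], hence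
    null-homotopic on the augmented resolution; [sigma] is the first component of the homotopy. *)
Lemma null_homotopy : exists s : forall i, 'M[S]_(rk i, rk i.+1),
  [/\ forall i, graded_mx (fun j => @wt i j + wf) (@wt i.+1) (s i),
      s 0%N *m D 0 + aug *m sigma = f%:M
    & forall i, s i.+1 *m D i.+1 + D i *m s i = f%:M].
Proof.
(* The equation in [Q] says that the rows of [f - D s] are cycles, which is what the next lift
   needs. *)
pose Q i (s : 'M[S]_(rk i, rk i.+1)) :=
  graded_mx (fun j => @wt i j + wf) (@wt i.+1) s /\ D i *m s *m D i = f *: D i.
have [s0 g0 h0] : exists2 s, graded_mx (fun j => @wt 0 j + wf) (@wt 1) s &
    f%:M - aug *m sigma = s *m D 0.
  apply: graded_exact_lift (fun w => proj1 (exact0 w)) (@gD 0%N) _ _.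
    apply: graded_mxB; first exact: gfM.
    apply: (@graded_mx_mul _ _ _ _ _ _ (fun _ => wf)) => //.
    move=> i j; have := @gaug i j; rewrite subr0.
    by rewrite [_ + wf]addrC addrAC subrr add0r.
  by rewrite mulmxBl -mulmxA sigma_aug mul_scalar_mx mul_mx_scalar subrr.
have Q0 : Q 0%N s0.
  by split=> //; rewrite -mulmxA -h0 mulmxBr mulmxA diff_aug mul0mx subr0 mul_mx_scalar.
have step i s : Q i s -> exists s', Q i.+1 s' /\ s' *m D i.+1 = f%:M - D i *m s.
  move=> [gs hs].
  have [s' gs' hs'] : exists2 s', graded_mx (fun j => @wt i.+1 j + wf) (@wt i.+2) s' &
      f%:M - D i *m s = s' *m D i.+1.
    apply: graded_exact_lift (fun w => proj1 (exactS w)) (@gD i.+1) _ _.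
      apply: graded_mxB; first exact: gfM.
      apply: graded_mx_mul gs => j k; have := @gD i j k.
      by rewrite opprD addrACA subrr addr0.
    by rewrite mulmxBl hs mul_scalar_mx subrr.
  exists s'; split=> //; split=> //.
  by rewrite -mulmxA -hs' mulmxBr mulmxA diff_diff mul0mx subr0 mul_mx_scalar.
(* Each map is chosen from the previous one and its proof of [Q], so the recursion runs on dependent
   pairs. *)
pose next i (x : {s | Q i s}) : {s | Q i.+1 s} :=
  let y := cid (step i (sval x) (svalP x)) in exist _ (sval y) (proj1 (svalP y)).
pose sq := nat_rect (fun i => {s | Q i s}) (exist _ s0 Q0) next.
exists (fun i => sval (sq i)); split=> [i||i].
- by have [] := svalP (sq i).
- by rewrite /= -h0 subrK.
- by rewrite /= (proj2 (svalP (cid (step i _ _)))) subrK.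
Qed.

End NullHomotopy.

(** * The two Euler characteristics *)

Section MonomialScaling.
Variables (R : realType) (d : nat).
Local Notation S := (Cpoly R d).
Implicit Types P : pred 'X_{1..d}.

Lemma supportedXM P m0 (g : S) :
  supported P ('X_[m0] * g) <-> supported (fun m => P (m0 + m)%MM) g.
Proof.
split=> h m; rewrite mcoeff_msupp => gm.
  by apply: h; rewrite mcoeff_msupp mcoeffXM lem_addr addmC addmK.
move: gm; rewrite mcoeffXM; case: ifP => [le|]; last by rewrite eqxx.
by rewrite -mcoeff_msupp => /h; rewrite addmC submK.
Qed.

Lemma scale_monomial_inj m n m0 : injective (fun A : 'M[S]_(m, n) => 'X_[m0] *: A).
Proof.
move=> A B /matrixP h; apply/matrixP => i j; have := h i j; rewrite !mxE.
by apply: mulfI; rewrite -msupp_eq0 msuppX.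
Qed.

Lemma entries_inZ m n P m0 (A : 'M[S]_(m, n)) :
  entries_in P ('X_[m0] *: A) <-> entries_in (fun m => P (m0 + m)%MM) A.
Proof.
split=> h i j; have := h i j; first by rewrite mxE => /supportedXM.
by rewrite mxE => hA; apply/supportedXM.
Qed.

Lemma graded_mxZ m n m0 (a a' : 'I_m -> weight d) (b b' : 'I_n -> weight d)
    (A : 'M[S]_(m, n)) :
  (forall i j, a i - b j = a' i - b' j + mnm_weight m0) ->
  graded_mx a b ('X_[m0] *: A) <-> graded_mx a' b' A.
Proof.
move=> ab.
have E i j m1 : of_weight (a i - b j) (m0 + m1)%MM = of_weight (a' i - b' j) m1.
  rewrite /of_weight mnm_weightD ab opprD addrA addrC addrA.
  congr (const_weight _); apply/ffunP => l; rewrite !weightE; lia.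
split=> h i j; have := h i j; rewrite mxE.
  by move/supportedXM; apply: supported_sub => m1; rewrite E.
by move=> hA; apply/supportedXM; apply: supported_sub hA => m1; rewrite E.
Qed.

Lemma entries_in_dvd m n m0 (A : 'M[S]_(m, n)) :
  entries_in (fun m => m0 <= m)%MM A -> exists B, A = 'X_[m0] *: B.
Proof.
move=> hA.
have /choice [g hg] : forall ij : 'I_m * 'I_n, exists g : S, A ij.1 ij.2 = 'X_[m0] * g.
  move=> [i j]; have [g gE _] := supported_dvd (hA i j) (hA i j).
  by exists g.
by exists (\matrix_(i, j) g (i, j)); apply/matrixP => i j; rewrite !mxE -hg.
Qed.

Lemma entries_in_sub m n P (Q : pred 'X_{1..d}) (A : 'M[S]_(m, n)) :
  (forall m, P m -> Q m) -> entries_in P A -> entries_in Q A.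
Proof. by move=> PQ hA i j; apply: supported_sub (hA i j). Qed.

Lemma entries_in_mulmx m n p P (A : 'M[S]_(m, n)) (B : 'M[S]_(n, p)) :
  (forall m m', P m -> P (m + m')%MM) -> entries_in P A -> entries_in P (A *m B).
Proof.
move=> up hA i j; rewrite mxE; apply: supported_sum => k _.
apply: (supportedM (hA i k) (P2 := xpredT)) => // m1 m2 h _; exact: up.
Qed.

Lemma entries_in_mulmxl m n p P (A : 'M[S]_(m, n)) (B : 'M[S]_(n, p)) :
  (forall m m', P m -> P (m + m')%MM) -> entries_in P B -> entries_in P (A *m B).
Proof.
move=> up hB i j; rewrite mxE; apply: supported_sum => k _; rewrite mulrC.
apply: (supportedM (hB k j) (P2 := xpredT)) => // m1 m2 h _; exact: up.
Qed.

End MonomialScaling.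

(** For a complex with terms of dimension [n i], exact up to a cokernel of dimension [q] in degree
    0, [rho i] is the rank of the map arriving in degree [i]. The vanishing of [n L.+1] forces that
    of [rho L]. *)
Lemma alternating_telescope (n rho : nat -> nat) (q L : nat) :
  n 0%N = (rho 0%N + q)%N -> (forall i, n i.+1 = (rho i.+1 + rho i)%N) ->
  n L.+1 = 0%N -> \sum_(i < L.+1) (-1) ^+ i * (n i)%:Z = q%:Z.
Proof.
move=> n0 nS nL.
have E l : \sum_(i < l.+1) (-1) ^+ i * (n i)%:Z = q%:Z + (-1) ^+ l * (rho l)%:Z.
  elim: l => [|l IH]; first by rewrite big_ord1 n0 PoszD expr0 !mul1r addrC.
  by rewrite big_ord_recr /= IH nS PoszD exprS; ring.
have rL : rho L = 0%N by have := nS L; lia.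
by rewrite E rL mulr0 addr0.
Qed.

Section Resolution.
Variables (R : realType) (e : nat).
Local Notation d := e.+2.
Local Notation S := (Cpoly R d).
Local Notation xpow N := (x0_power e N).
Variables (J : pred 'X_{1..d}) (boxes : seq 'X_{1..d}) (M : nat).
Hypothesis JP : monomial_ideal J boxes M.
Variables (rk : nat -> nat) (wt : forall i, 'I_(rk i) -> weight d).
Variables (D : forall i, 'M[S]_(rk i.+1, rk i)) (aug : 'cV[S]_(rk 0)) (L : nat).
Hypothesis gD : forall i, graded_mx (@wt i.+1) (@wt i) (D i).
Hypothesis gaug : graded_mx (@wt 0) (fun _ => 0) aug.
Hypothesis rk_bounded : forall i, (L < i)%N -> rk i = 0%N.
Hypothesis aug_image : forall f,
  supported J f <-> exists v : 'rV_(rk 0), f = (v *m aug) 0 0.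
Hypothesis exact0 : forall v : 'rV_(rk 0),
  v *m aug = 0 <-> exists u : 'rV_(rk 1), v = u *m D 0.
Hypothesis exactS : forall i (v : 'rV_(rk i.+1)),
  v *m D i = 0 <-> exists u : 'rV_(rk i.+2), v = u *m D i.+1.

Lemma J_up m m' : J m -> J (m + m')%MM. Proof. exact: (mi_up JP). Qed.

Lemma x0_ideal (m : 'X_{1..d}) : (M <= m ord0)%N -> J m.
Proof. by rewrite -x0_power_le => /submK <-; rewrite addmC; apply/J_up/(mi_power JP). Qed.

Lemma shifted_idealD N m : shifted_ideal J N (xpow N + m)%MM = J m.
Proof. by rewrite /shifted_ideal lem_addr [(xpow N + m)%MM]addmC addmK. Qed.

Lemma shifted_ideal_up N m m' : shifted_ideal J N m -> shifted_ideal J N (m + m')%MM.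
Proof. by move=> /andP[le h]; rewrite -(submK le) [(_ + xpow N)%MM]addmC -addmA shifted_idealD J_up. Qed.

Lemma rk_empty i (j : 'I_(rk i)) : (L < i)%N -> False.
Proof. by move=> /rk_bounded rk0; have := leq_ltn_trans (leq0n j) (ltn_ord j); rewrite rk0. Qed.

Lemma sum_bound (g : forall i, 'I_(rk i) -> nat) i (j : 'I_(rk i)) :
  (g i j <= \sum_(i < L.+1) \sum_(j < rk i) g i j)%N.
Proof.
have [iL|/(rk_empty j) //] := ltnP i L.+1.
by rewrite (bigD1 (Ordinal iL)) //= (bigD1 j) //= -addnA leq_addr.
Qed.

Lemma graded_aug_lift (c : weight d) (g : S) : supported J g -> supported (of_weight c) g ->
  exists2 u : 'rV_(rk 0), graded_mx (fun _ => c) (@wt 0) u & u *m aug = g%:M.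
Proof.
move=> /aug_image [u gE] cg.
have [||v gv vE] := @graded_lift _ _ _ _ 1 (@wt 0) (fun _ => 0) (fun _ => c) aug g%:M gaug.
- by move=> i j; rewrite mxE (ord1 i) (ord1 j) eqxx subr0.
- by exists u; apply/matrixP => i j; rewrite mxE (ord1 i) (ord1 j) eqxx gE.
by exists v.
Qed.

(** * The resolution tensored with [S[1/x_0] / S] *)

Section RowComplex.
Variable y : weight d.
(** Multiplied by [x_0^N], the weight [y] parts of F_i[1/x_0] and F_i become [B i] and [A i], and
    those of S[1/x_0] and I become [B'] and [A']. The sum in [N] bounds the poles in all F_i; the
    summand [neg_count y + M] makes the augmentation onto. *)
Let N := (neg_count y + M + \sum_(i < L.+1) \sum_(j < rk i) neg_count (y - wt j))%N.
Let c (_ : 'I_1) : weight d := y + mnm_weight (xpow N).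
Let B i : 'M[S]_(1, rk i) -> Prop := graded_mx c (@wt i).
Let A i (v : 'M[S]_(1, rk i)) := B v /\ entries_in (fun m => xpow N <= m)%MM v.
Let B' : 'M[S]_1 -> Prop := graded_mx c (fun _ => 0).
Let A' (v : 'M[S]_1) := B' v /\ entries_in (shifted_ideal J N) v.
Let Im i (z : 'M[S]_(1, rk i)) := exists2 b, B b & A (z - b *m D i).

Let le_up m m' : (xpow N <= m)%MM -> (xpow N <= m + m')%MM.
Proof. by move=> h; apply: lepm_trans h _; apply: lem_addr. Qed.

Let sB i : subspace (@B i). Proof. exact: graded_mx_subspace. Qed.
Let sA i : subspace (@A i).
Proof. by apply: subspaceI; [apply: graded_mx_subspace | apply: entries_in_subspace]. Qed.
Let sB' : subspace B'. Proof. exact: graded_mx_subspace. Qed.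
Let sA' : subspace A'.
Proof. by apply: subspaceI; [apply: graded_mx_subspace | apply: entries_in_subspace]. Qed.

Let BD i (v : 'M[S]_(1, rk i.+1)) : B v -> B (v *m D i).
Proof. by move=> Bv; apply: graded_mx_mul Bv _; apply: gD. Qed.

Let AD i (v : 'M[S]_(1, rk i.+1)) : A v -> A (v *m D i).
Proof. by case=> Bv xv; split; [exact: BD | apply: entries_in_mulmx xv; exact: le_up]. Qed.

Let graded_scale i (v : 'M[S]_(1, rk i)) :
  B ('X_[xpow N] *: v) <-> graded_mx (fun _ => y) (@wt i) v.
Proof. by apply: graded_mxZ => j k; rewrite /c addrAC. Qed.

Let A_scale i (v : 'M[S]_(1, rk i)) : graded_mx (fun _ => y) (@wt i) v -> A ('X_[xpow N] *: v).
Proof.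
by move=> gv; split; [apply/graded_scale | apply/entries_inZ => j k m _; exact: lem_addr].
Qed.

(** If [z D] is divisible by [x_0^N], the quotient is a cycle, hence a boundary [u D]. Then
    [z - x_0^N u] is a cycle, and so a boundary too. *)
Let kernelS i (z : 'M[S]_(1, rk i.+1)) : B z /\ A (z *m D i) <-> Im z.
Proof.
split=> [[Bz [Bzd /entries_in_dvd [w wE]]] | [b Bb Azb]]; last first.
  have Bz : B z.
    rewrite -[z](subrK (b *m D i.+1)); case: (sB i.+1) => _ + _; apply; last exact: BD.
    by case: Azb.
  split=> //; have := AD Azb; rewrite mulmxBl -mulmxA.
  by rewrite (diff_diff exactS) mulmx0 subr0.
have gw : graded_mx (fun _ => y) (@wt i) w by apply/graded_scale; rewrite -wE.
have [u gu uE] : exists2 u, graded_mx (fun _ => y) (@wt i.+1) u & w = u *m D i.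
  case: i z Bz Bzd w wE gw => [|i] z Bz Bzd w wE gw.
    apply: (graded_exact_lift (fun w => proj1 (exact0 w)) (@gD 0%N) gw).
    apply: (scale_monomial_inj (m0 := xpow N)).
    by rewrite scalemxAl -wE -mulmxA (diff_aug exact0) mulmx0 scaler0.
  apply: (graded_exact_lift (fun w => proj1 (exactS w)) (@gD i.+1) gw).
  apply: (scale_monomial_inj (m0 := xpow N)).
  by rewrite scalemxAl -wE -mulmxA (diff_diff exactS) mulmx0 scaler0.
have [Bu Au] := A_scale gu.
have [||v gv vE] := graded_exact_lift (fun w => proj1 (exactS w)) (@gD i.+1)
    (v := z - 'X_[xpow N] *: u) (c := c).
- exact: graded_mxB.
- by rewrite mulmxBl -scalemxAl -uE wE subrr.
by exists v => //; rewrite -vE opprB addrC subrK.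
Qed.

(** The same argument at the end of the complex, where the image of the augmentation is [I]. *)
Let kernel0 (z : 'M[S]_(1, rk 0)) : B z /\ A' (z *m aug) <-> Im z.
Proof.
split=> [[Bz [Bza Jza]] | [b Bb Azb]]; last first.
  have Bz : B z.
    rewrite -[z](subrK (b *m D 0)); case: (sB 0) => _ + _; apply; last exact: BD.
    by case: Azb.
  have -> : z *m aug = (z - b *m D 0) *m aug.
    by rewrite mulmxBl -mulmxA (diff_aug exact0) mulmx0 subr0.
  have [Bzb /entries_in_dvd [w wE]] := Azb.
  split=> //; split; first exact: (graded_mx_mul Bzb gaug).
  rewrite wE -scalemxAl; apply/entries_inZ.
  move=> i j; apply: (@supported_sub _ _ J) => [m|]; first by rewrite shifted_idealD.
  by apply/aug_image; exists w; rewrite (ord1 i) (ord1 j).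
have [w wE] : exists w, z *m aug = 'X_[xpow N] *: w.
  by apply: entries_in_dvd; apply: entries_in_sub Jza => m /andP[].
have Jw : supported J (w 0 0).
  rewrite wE in Jza; have /entries_inZ /(_ 0 0) := Jza.
  by apply: supported_sub => m; rewrite shifted_idealD.
have yw : supported (of_weight y) (w 0 0).
  have yE (i j : 'I_1) : c i - 0 = y - 0 + mnm_weight (xpow N) by rewrite /c !subr0.
  have := Bza; rewrite wE => /(proj1 (graded_mxZ _ (a' := fun _ => y) (b' := fun _ => 0) yE)).
  by move=> h; have := h 0 0; rewrite subr0.
have [u gu uE] := graded_aug_lift Jw yw.
have wM : (w 0 0)%:M = w by rewrite -mx11_scalar.
have [Bu Au] := A_scale gu.
have [||v gv vE] := graded_exact_lift (fun w => proj1 (exact0 w)) (@gD 0%N)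
    (v := z - 'X_[xpow N] *: u) (c := c).
- exact: graded_mxB.
- by rewrite mulmxBl -scalemxAl uE wM wE subrr.
by exists v => //; rewrite -vE opprB addrC subrK.
Qed.

Let n i := (\sum_(j < rk i) neg_count (y - wt j))%N.

Let dimBA i : dim_quot (@B i) (@A i) (n i).
Proof.
(* Counting modulo S instead of I is the case of the unit ideal, which has no boxes. *)
have JT : @monomial_ideal d xpredT [::] 0 by split.
have le j : (neg_count (y - wt j) <= N)%N.
  by apply: leq_trans (leq_addl _ _); apply: (sum_bound (fun i j => neg_count (y - wt j))).
pose Ls (_ : 'I_1) j := quot_mnms [::] (y - @wt i j) N.
have := @dim_quot_graded_mx R d 1 (rk i) c (@wt i) (fun m => xpow N <= m)%MM Ls.
rewrite /= big_ord1 (eq_bigr (fun j => neg_count (y - wt j))); last first.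
  by move=> j _; rewrite size_quot_mnms /quot_count addn0.
apply=> [k j | k j m']; first exact: (quot_mnms_uniq JT).
by rewrite (mem_quot_mnms JT) // /shifted_ideal andbT /c [y + _ - _]addrAC.
Qed.

Let dimBA' : dim_quot B' A' (quot_count boxes y).
Proof.
have le : (neg_count y <= N)%N by rewrite /N -addnA leq_addr.
have := @dim_quot_graded_mx R d 1 1 c (fun _ => 0) (shifted_ideal J N)
  (fun _ _ => quot_mnms boxes y N).
rewrite /= big_ord1 big_ord1 size_quot_mnms; apply=> [i j|i j m]; first exact: (quot_mnms_uniq JP).
by rewrite (mem_quot_mnms JP) // /c subr0.
Qed.

(** This is I[1/x_0] = S[1/x_0]: by the choice of [N], every monomial of the weight in question has
    exponent at least [M] in [x_0]. *)
Let aug_onto z : B' z <-> exists2 b, B b & A' (z - b *m aug).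
Proof.
split=> [Bz | [b Bb [Bzb _]]]; last first.
  rewrite -[z](subrK (b *m aug)); case: sB' => _ + _; apply=> //.
  exact: graded_mx_mul Bb gaug.
have wz : supported (of_weight (c 0)) (z 0 0) by have := Bz 0 0; rewrite subr0.
have [|u gu uE] := graded_aug_lift _ wz.
  move=> m /wz /of_weight_x0_power h; apply: x0_ideal.
  by move: h; rewrite /N; lia.
exists u => //; rewrite uE -mx11_scalar subrr; case: sA' => //.
Qed.

(** The complex is exact except in degree 0, where the augmentation identifies its cokernel with
    S[1/x_0] / I. Its Euler characteristic in weight [y] is thus the dimension of that weight
    space. *)
Lemma row_complex_euler :
  \sum_(i < L.+1) (-1) ^+ i * (\sum_(j < rk i) neg_count (y - wt j))%N%:Z =
  (quot_count boxes y)%:Z.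
Proof.
have AIm i z : @A i z -> Im z.
  by move=> Az; exists 0; rewrite ?mul0mx ?subr0 //; case: (sB i.+1).
have AA' (z : 'M_(1, rk 0)) : A z -> A' (mulmxr aug z).
  by move=> /AIm /kernel0 [].
have [k0 [r0 [E0 hk0 hr0]]] := dim_quot_rank_nullity (sB 0) (sA 0) sA'
  (fun z => @proj1 _ _) AA' (@dimBA 0).
have hq : r0 = quot_count boxes y.
  apply: (dim_quot_uniq sB' sA' _ dimBA').
  by apply: eq_dim_quot hr0 => z //; rewrite aug_onto.
have dimIm0 : dim_quot (@Im 0) (@A 0) k0 by apply: eq_dim_quot hk0 => z //; rewrite kernel0.
have RN i : exists kr : nat * nat, [/\ n i.+1 = (kr.1 + kr.2)%N,
    dim_quot (@Im i.+1) (@A i.+1) kr.1 & dim_quot (@Im i) (@A i) kr.2].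
  have [k [r [E hk hr]]] := dim_quot_rank_nullity (sB i.+1) (sA i.+1) (sA i)
    (fun z => @proj1 _ _) (@AD i : forall z, A z -> A (mulmxr (D i) z)) (@dimBA i.+1).
  by exists (k, r); split=> //; apply: eq_dim_quot hk => z //; rewrite kernelS.
have [kr hkr] := choice RN.
pose rho i := (kr i).2.
have sIm i : subspace (@Im i).
  have [A0 AaddA AZ] := sA i; have [B0 BaddB BZ] := sB i.+1.
  split=> [|u v [b Bb Ab] [b' Bb' Ab']|a u [b Bb Ab]].
  - exact: AIm.
  - exists (b + b'); first exact: BaddB.
    have -> : u + v - (b + b') *m D i = (u - b *m D i) + (v - b' *m D i).
      by rewrite mulmxDl opprD addrACA.
    exact (AaddA _ _ Ab Ab').
  - exists (a%:MP *: b); first exact: BZ.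
    have -> : a%:MP *: u - (a%:MP *: b) *m D i = a%:MP *: (u - b *m D i).
      by rewrite -scalemxAl scalerBr.
    exact (AZ _ _ Ab).
apply: (@alternating_telescope n rho).
- have [_ _ h] := hkr 0%N.
  by rewrite E0 hq /rho (dim_quot_uniq (sIm 0) (sA 0) h dimIm0).
- move=> i; have [-> h1 _] := hkr i; have [_ _ h2] := hkr i.+1.
  by rewrite /rho (dim_quot_uniq (sIm i.+1) (sA i.+1) h1 h2).
by rewrite /n; apply: big1 => j; case: (rk_empty j (ltnSn L)).
Qed.

End RowComplex.

(** * Homomorphisms from the resolution to [S[1/x_0] / I] *)

Section ColumnComplex.
(** Again multiplied by [x_0^N], the invariant homomorphisms from F_i to S[1/x_0] become [B i], and
    those with values in I become [A i]; the latter are [H i] before the multiplication. *)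
Let N := (M + \sum_(i < L.+1) \sum_(j < rk i) neg_count (wt j))%N.
Let c (_ : 'I_1) : weight d := - mnm_weight (xpow N).
Let B i : 'cV[S]_(rk i) -> Prop := graded_mx (@wt i) c.
Let A i (v : 'cV[S]_(rk i)) := B v /\ entries_in (shifted_ideal J N) v.
Let H i (v : 'cV[S]_(rk i)) := graded_mx (@wt i) (fun _ => 0) v /\ entries_in J v.
Let Z i (v : 'cV[S]_(rk i)) := B v /\ A (D i *m v).
(** As Hom(F, S[1/x_0]) is exact in positive degrees, this is [A i] plus the coboundaries for
    [i > 0], and it is [A 0] for [i = 0]. Thus [Z i / Y i] is the cohomology of Hom(F, S[1/x_0] /
    I). *)
Let Y i (v : 'cV[S]_(rk i)) := B v /\ exists2 a, A a & D i *m v = D i *m a.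

Let sB i : subspace (@B i). Proof. exact: graded_mx_subspace. Qed.
Let sA i : subspace (@A i).
Proof. by apply: subspaceI; [apply: graded_mx_subspace | apply: entries_in_subspace]. Qed.

Let sZ i : subspace (@Z i).
Proof.
have [B0 BD BZ] := sB i; have [A0 AD AZ] := sA i.+1.
split=> [|u v [Bu Au] [Bv Av]|a u [Bu Au]].
- by split=> //; rewrite mulmx0.
- by split; [apply: BD | rewrite mulmxDr; apply: AD].
- by split; [apply: BZ | rewrite -scalemxAr; apply: AZ].
Qed.

Let sY i : subspace (@Y i).
Proof.
have [B0 BD BZ] := sB i; have [A0 AD AZ] := sA i.
split=> [|u v [Bu [a Aa Ea]] [Bv [b Ab Eb]]|x u [Bu [a Aa Ea]]].
- by split=> //; exists 0.
- by split; [apply: BD | exists (a + b); rewrite ?mulmxDr ?Ea ?Eb //; apply: AD].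
- by split; [apply: BZ | exists (x%:MP *: a); rewrite -?scalemxAr ?Ea //; apply: AZ].
Qed.

Let BD i (v : 'cV[S]_(rk i)) : B v -> B (D i *m v).
Proof. by move=> Bv; apply: (graded_mx_mul (@gD i) Bv). Qed.

Let AD i (v : 'cV[S]_(rk i)) : A v -> A (D i *m v).
Proof. by case=> Bv Jv; split; [exact: BD | apply: entries_in_mulmxl Jv; exact: shifted_ideal_up]. Qed.

Let AY i z : @A i z -> Y z. Proof. by move=> Az; split; [case: Az | exists z]. Qed.

Let YZ i z : @Y i z -> Z z.
Proof. by case=> Bz [a Aa E]; split=> //; rewrite E; apply: AD. Qed.

Let graded_scale i (v : 'cV[S]_(rk i)) :
  B ('X_[xpow N] *: v) <-> graded_mx (@wt i) (fun _ => 0) v.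
Proof. by apply: graded_mxZ => j k; rewrite /c opprK subr0. Qed.

Let A_scale i (v : 'cV[S]_(rk i)) : A ('X_[xpow N] *: v) <-> H v.
Proof.
split=> [[Bv Jv] | [gv Jv]]; split; try exact/graded_scale.
  by move/entries_inZ: Jv; apply: entries_in_sub => m; rewrite shifted_idealD.
by apply/entries_inZ; apply: entries_in_sub Jv => m; rewrite shifted_idealD.
Qed.

Let A_dvd i (v : 'cV[S]_(rk i)) : A v -> exists2 w, v = 'X_[xpow N] *: w & H w.
Proof.
move=> Av; have [w vE] : exists w, v = 'X_[xpow N] *: w.
  by case: Av => _ Jv; apply: entries_in_dvd; apply: entries_in_sub Jv => m /andP[].
by exists w => //; apply/A_scale; rewrite -vE.
Qed.

Let le_wt i (j : 'I_(rk i)) : (neg_count (wt j) <= N)%N.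
Proof. by apply: leq_trans (leq_addl _ _); apply: (sum_bound (fun i j => neg_count (wt j))). Qed.

Let x0_powerD k l : mnm_weight (xpow (k + l)) = mnm_weight (xpow k) + mnm_weight (xpow l).
Proof.
rewrite -mnm_weightD; congr mnm_weight; apply/mnmP => i.
by rewrite mnmDE !x0_powerE; case: eqP.
Qed.

(* The monomial x_0^M of the ideal annihilates the quotient by the ideal, hence
   is homotopic to zero on the resolution. *)
Let homotopy : exists (s : forall i, 'M[S]_(rk i, rk i.+1)) (sigma : 'rV[S]_(rk 0)),
  [/\ forall i, graded_mx (fun j => @wt i j + mnm_weight (xpow M)) (@wt i.+1) (s i),
      graded_mx (fun _ => mnm_weight (xpow M)) (@wt 0) sigma,
      s 0%N *m D 0 + aug *m sigma = 'X_[xpow M]%:M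
    & forall i, s i.+1 *m D i.+1 + D i *m s i = 'X_[xpow M]%:M].
Proof.
have wX : supported (of_weight (mnm_weight (xpow M))) ('X_[xpow M] : S).
  by apply: supportedX; rewrite /of_weight subrr const_weight0.
have JX : supported J ('X_[xpow M] : S) by apply/supportedX/(mi_power JP).
have [sigma gs sE] := graded_aug_lift JX wX.
have [s [g0 h0 hS]] := null_homotopy gD gaug exact0 exactS gs wX sE.
by exists s, sigma.
Qed.

(** For a cocycle [v] the homotopy gives x_0^M v = D (s v). The pole bound makes [s v] divisible by
    x_0^M, and the division yields a preimage. *)
Let exactB i (v : 'cV[S]_(rk i.+1)) : B v -> D i.+1 *m v = 0 ->
  exists2 b, B b & v = D i *m b.
Proof.
move=> Bv Dv; have [s [_ [gs _ _ hs]]] := homotopy.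
have E : 'X_[xpow M] *: v = D i *m (s i *m v).
  by rewrite -mul_scalar_mx -hs mulmxDl -mulmxA Dv mulmx0 add0r mulmxA.
have gsv := graded_mx_mul (@gs i) Bv.
have [w wE] : exists w, s i *m v = 'X_[xpow M] *: w.
  apply: entries_in_dvd => j k; apply: supported_sub (gsv j k) => m.
  rewrite /c opprK -addrA -x0_powerD x0_power_le => /of_weight_x0_power.
  by have := le_wt j; lia.
have vE : v = D i *m w.
  by apply: (scale_monomial_inj (m0 := xpow M)); rewrite /= E wE -scalemxAr.
exists w; last exact: vE.
move: gsv; rewrite wE; apply: (proj1 (graded_mxZ _ _)) => j k.
by rewrite [wt j + _ - _]addrAC.
Qed.

(** A cocycle of degree 0 is multiplication by a T-invariant function. Such a function has no pole,
    as [neg_count 0 = 0], so the cocycle has values in [I]. *)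
Let exactB0 (v : 'cV[S]_(rk 0)) : B v -> D 0 *m v = 0 -> A v.
Proof.
move=> Bv Dv; have [s [sigma [_ gs hs _]]] := homotopy.
have E : 'X_[xpow M] *: v = aug *m (sigma *m v).
  by rewrite -mul_scalar_mx -hs mulmxDl -mulmxA Dv mulmx0 add0r mulmxA.
have gsv := graded_mx_mul gs Bv.
have [w wE] : exists w, sigma *m v = 'X_[xpow (M + N)] *: w.
  apply: entries_in_dvd => j k; apply: supported_sub (gsv j k) => m.
  rewrite /c opprK -x0_powerD -[mnm_weight _]add0r => /of_weight_x0_power.
  by rewrite neg_count0 addn0 x0_power_le.
have vE : v = 'X_[xpow N] *: (aug *m w).
  apply: (scale_monomial_inj (m0 := xpow M)); rewrite /= E wE -scalemxAr scalerA -mpolyXD.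
  congr ('X_[_] *: _); apply: mnm_weight_inj.
  by rewrite x0_powerD mnm_weightD.
split=> //; rewrite vE; apply/entries_inZ.
apply: (entries_in_sub (P := J)) => [m|]; first by rewrite shifted_idealD.
apply: entries_in_mulmx => [m m'|j k]; first exact: J_up.
apply/aug_image; exists (delta_mx 0 j).
by rewrite -rowE mxE (ord1 k).
Qed.

Let n i := (\sum_(j < rk i) quot_count boxes (wt j))%N.

Let dimBA i : dim_quot (@B i) (@A i) (n i).
Proof.
pose Ls j (_ : 'I_1) := quot_mnms boxes (@wt i j) N.
have := @dim_quot_graded_mx R d (rk i) 1 (@wt i) c (shifted_ideal J N) Ls.
rewrite /= (eq_bigr (fun j => quot_count boxes (wt j))); last first.
  by move=> j _; rewrite big_ord1 size_quot_mnms.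
apply=> [j k | j k m']; first exact: (quot_mnms_uniq JP).
by rewrite (mem_quot_mnms JP) // /c opprK.
Qed.

Let Y_image i z : @Y i.+1 z <-> exists2 b, B b & A (z - D i *m b).
Proof.
split=> [[Bz [a Aa E]] | [b Bb Ab]].
  have [||b Bb bE] := @exactB i (z - a).
  - by apply: graded_mxB => //; case: Aa.
  - by rewrite mulmxBr E subrr.
  by exists b => //; rewrite -bE opprB addrC subrK.
split; last first.
  by exists (z - D i *m b); rewrite // mulmxBr mulmxA (diff_diff exactS) mul0mx subr0.
rewrite -[z](subrK (D i *m b)); case: (sB i.+1) => _ + _; apply; last exact: BD.
by case: Ab.
Qed.

Let Y0 z : @Y 0 z <-> A z.
Proof.
split=> [[Bz [a Aa E]]|]; last exact: AY.
rewrite -[z](subrK a); case: (sA 0) => _ + _; apply=> //; apply: exactB0.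
  by apply: graded_mxB => //; case: Aa.
by rewrite mulmxBr E subrr.
Qed.

Let cocycle i (v : 'cV[S]_(rk i.+1)) := H v /\ D i.+1 *m v = 0.
Let coboundary i (v : 'cV[S]_(rk i.+1)) := exists2 b, H b & v = D i *m b.

(* The connecting homomorphism from Hom(F, S[1/x_0] / I) to Hom(F, I). *)
Let dim_connecting i h : dim_quot (@Z i) (@Y i) h -> dim_quot (@cocycle i) (@coboundary i) h.
Proof.
(* Up to the factor [x_0^N], [T] consists of the coboundaries with values in I. Its preimage in [Z]
   is [Y], so [D i] embeds [Z / Y] modulo [T]. *)
pose T (z : 'cV[S]_(rk i.+1)) := exists2 a, A a & z = D i *m a.
have sT : subspace T.
  have [A0 AD' AZ] := sA i.
  split=> [|u v [a Aa ->] [b Ab ->]|x u [a Aa ->]].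
  - by exists 0; rewrite ?mulmx0.
  - by exists (a + b); rewrite ?mulmxDr //; apply: AD'.
  - by exists (x%:MP *: a); rewrite -?scalemxAr //; apply: AZ.
have TY b : Z b -> T (mulmx (D i) b) <-> Y b.
  by move=> [Bb _]; split=> [[a Aa E]|[_ [a Aa E]]]; [split=> // | ]; exists a.
move=> hZ; have := dim_quot_image (sZ i) sT TY hZ.
have scaleE (z : 'cV[S]_(rk i.+1)) : 'X_[xpow N]%:M *m z = 'X_[xpow N] *: z.
  exact: mul_scalar_mx.
apply: (@dim_quot_preimage R d 'cV[S]_(rk i.+1) 'cV[S]_(rk i.+1)
  (mulmx ('X_[xpow N]%:M : 'M[S]_(rk i.+1)))).
- move=> z [b [_ Ab] [a Aa E]].
  have Az : A z.
    rewrite -[z](subrK (D i *m b)) E.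
    by have [_ AaddA _] := sA i.+1; apply: (AaddA _ _ (AD Aa) Ab).
  by have [w wE _] := A_dvd Az; exists w; rewrite /= scaleE.
- move=> z; rewrite /= scaleE; split=> [[b [Bb Ab] [a Aa E]] | [Hz Dz]].
    have zE : 'X_[xpow N] *: z = D i *m a + D i *m b by rewrite -E subrK.
    split.
      apply/A_scale; rewrite zE.
      by have [_ AaddA _] := sA i.+1; apply: (AaddA _ _ (AD Aa) Ab).
    apply: (scale_monomial_inj (m0 := xpow N)).
    by rewrite /= [LHS]scalemxAr zE mulmxDr !mulmxA (diff_diff exactS) !mul0mx addr0 scaler0.
  have Az : A ('X_[xpow N] *: z) by apply/A_scale.
  have DXz : D i.+1 *m ('X_[xpow N] *: z) = 0 by rewrite -scalemxAr Dz scaler0.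
  have [b Bb bE] := exactB (proj1 Az) DXz.
  exists b; first by split=> //; rewrite -bE.
  by rewrite /= bE subrr; case: sT.
- move=> z; rewrite /= scaleE; split=> [[a Aa E] | [b Hb ->]].
    have [w aE Hw] := A_dvd Aa; exists w => //.
    by apply: (scale_monomial_inj (m0 := xpow N)); rewrite /= E aE -scalemxAr.
  by exists ('X_[xpow N] *: b); [apply/A_scale | rewrite -scalemxAr].
Qed.

(** The filtration [A], [Y], [Z], [B] splits [n i] into [y i], [h i] and the rank of [D i] modulo
    [A], which is [y i.+1] by exactness. In the alternating sum the [y i] telescope away. *)
Lemma column_complex_dims : exists h : nat -> nat,
  (forall i, dim_quot (@cocycle i) (@coboundary i) (h i)) /\
  \sum_(i < L) (-1) ^+ i * (h i)%:Z = \sum_(i < L.+1) (-1) ^+ i * (n i)%:Z.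
Proof.
have /choice [t ht] i : exists t : nat * nat * nat, [/\ n i = (t.1.1 + t.1.2 + t.2)%N,
    dim_quot (@Y i) (@A i) t.1.1, dim_quot (@Z i) (@Y i) t.1.2
    & dim_quot (@Y i.+1) (@A i.+1) t.2].
  have [k [r [-> hk hr]]] := dim_quot_rank_nullity (sB i) (sA i) (sA i.+1)
    (fun z => @proj1 _ _) (@AD i : forall z, A z -> A (mulmx (D i) z)) (@dimBA i).
  have [k1 [k2 [-> hk1 hk2]]] := dim_quot_between (sA i) (sY i) (sZ i) (@AY i) (@YZ i) hk.
  exists (k1, k2, r); split=> //.
  by apply: eq_dim_quot hr => z //; rewrite Y_image.
pose y i := (t i).1.1; pose h i := (t i).1.2; exists h.
have yS i : (t i).2 = y i.+1.
  have [_ _ _ h1] := ht i; have [_ h2 _ _] := ht i.+1.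
  exact: dim_quot_uniq (sY i.+1) (sA i.+1) h1 h2.
have y0 : y 0%N = 0%N.
  have [_ h1 _ _] := ht 0%N; apply: dim_quot_uniq (sY 0) (sA 0) h1 _.
  by apply: dim_quot_self => // z /Y0.
have nE i : n i = (y i + h i + y i.+1)%N by have [-> _ _ _] := ht i; rewrite yS.
have nL : n L.+1 = 0%N.
  by rewrite /n big1 // => j; case: (rk_empty j (ltnSn L)).
have yL : y L.+1 = 0%N by have := nE L.+1; rewrite nL; lia.
(* Degree [L.+1] is zero, so [Z L] equals [Y L], and the sum of the [h i] stops before [L]. *)
have hL : h L = 0%N.
  have [_ _ h1 _] := ht L; apply: dim_quot_uniq (sZ L) (sY L) h1 _.
  apply: dim_quot_self => // z [Bz _]; split=> //; exists 0; first by case: (sA L).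
  by apply/matrixP => j; case: (rk_empty j (ltnSn L)).
split=> [i|]; first by have [_ _ h1 _] := ht i; apply: dim_connecting.
have E l : \sum_(i < l.+1) (-1) ^+ i * (n i)%:Z =
    \sum_(i < l.+1) (-1) ^+ i * (h i)%:Z + (-1) ^+ l * (y l.+1)%:Z.
  elim: l => [|l IH]; first by rewrite !big_ord1 nE y0 add0n PoszD expr0 !mul1r.
  rewrite big_ord_recr /= IH nE [in RHS]big_ord_recr /= !PoszD exprS; ring.
by rewrite E yL mulr0 addr0 big_ord_recr /= hL mulr0 addr0.
Qed.

End ColumnComplex.

End Resolution.

(** * The combinatorial identity *)

Section SignedSubsetSums.
Variable d : nat.
Implicit Types (A : {set 'I_d}) (v w : weight d).

Definition indicator A : weight d := [ffun i => (i \in A)%:Z].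

Lemma indicatorE A i : indicator A i = (i \in A)%:Z. Proof. exact: ffunE. Qed.

Definition set_sign A : int := (-1) ^+ #|A|.

Lemma set_signC A : set_sign (~: A) = (-1) ^+ d * set_sign A.
Proof.
rewrite /set_sign -[X in (-1) ^+ X * _](card_ord d) -(cardsC A) exprD mulrAC.
by rewrite -expr2 sqrr_sign mul1r.
Qed.

(** Adding or removing [i] pairs the subsets, with opposite signs and equal values of [phi]. *)
Lemma set_sign_toggle (phi : {set 'I_d} -> int) i :
  (forall A, phi (i |: A) = phi (A :\ i)) -> \sum_A set_sign A * phi A = 0.
Proof.
move=> hphi; pose h A := if i \in A then A :\ i else i |: A.
have hK : involutive h.
  move=> A; rewrite /h; have [iA|niA] := boolP (i \in A); first by rewrite setD11 setD1K.
  by rewrite setU11 setU1K.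
have sgn A : set_sign (h A) = - set_sign A.
  rewrite /set_sign /h; case: ifPn => iA; last by rewrite cardsU1 iA exprS mulN1r.
  by rewrite [#|A|](cardsD1 i) iA exprS mulN1r opprK.
have ph A : phi (h A) = phi A.
  rewrite /h; case: ifPn => iA; first by rewrite -hphi (setUidPr _) ?sub1set.
  by rewrite hphi (setDidPl _) // disjoint_sym disjoints1.
have E : \sum_A set_sign A * phi A = - \sum_A set_sign A * phi A.
  rewrite {1}(reindex_inj (can_inj hK)) -sumrN; apply: eq_bigr => A _.
  by rewrite sgn ph mulNr.
lia.
Qed.

Lemma set_sign_setC (phi : {set 'I_d} -> int) :
  \sum_A set_sign A * phi (~: A) = (-1) ^+ d * \sum_A set_sign A * phi A.
Proof.
rewrite (reindex_inj (@setC_inj _)) mulr_sumr; apply: eq_bigr => A _.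
by rewrite set_signC setCK mulrA.
Qed.

Lemma indicatorC A : indicator (~: A) = [ffun=> 1] - indicator A.
Proof.
apply/ffunP => i; rewrite weightDE weightNE !indicatorE !ffunE inE.
by case: (i \in A).
Qed.

End SignedSubsetSums.

Section EulerIdentity.
Variable e : nat.
Local Notation d := e.+2.
Implicit Types (A : {set 'I_d}) (v w y : weight d) (p : 'X_{1..d}).

Let full_min v : int := Num.min (tail_min v) (v ord0).

Let full_minP v (c : int) : (exists i, v i = c) -> (forall i, c <= v i) -> full_min v = c.
Proof.
move=> [i vi] le; have [j _ tE] := tail_minP v.
have h1 : c <= tail_min v by rewrite tE.
have := le ord0; rewrite /full_min.
case: (i =P ord0) vi => [-> | /eqP /(tail_min_le v)]; lia.
Qed.

Let full_min_attained v : exists2 i, v i = full_min v & forall j, full_min v <= v j.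
Proof.
have le j : full_min v <= v j.
  rewrite /full_min; case: (j =P ord0) => [->|/eqP /(tail_min_le v)]; lia.
have [j _ tE] := tail_minP v.
have [h|h] := leP (tail_min v) (v ord0).
  by exists j => //; rewrite /full_min -tE; lia.
by exists ord0 => //; rewrite /full_min; lia.
Qed.

(** [neg_count] is [tail_min] minus the minimum of all coordinates. The first ignores coordinate 0,
    so its signed sum cancels. Subtracting [A] lowers the second by 1 unless [A] misses the set
    where it is attained; the signed sum over the latter [A] is 1 if that set is everything, so that
    [v] is constant, and 0 otherwise. *)
Lemma neg_count_difference v :
  \sum_A set_sign A * (neg_count (v - indicator A))%:Z = - (const_weight v)%:Z.
Proof.
have rE w : (neg_count w)%:Z = tail_min w - full_min w.
  by rewrite neg_countE /full_min; lia.
under eq_bigr => A _ do rewrite rE mulrBr.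
rewrite sumrB (set_sign_toggle (i := ord0)) ?sub0r; last first.
  move=> A; have [j nj tj] := tail_minP (v - indicator (A :\ ord0)).
  rewrite tj; apply: tail_min_eq => [|i ni].
    by exists j => //; rewrite !weightE !indicatorE !inE (negPf nj).
  rewrite -tj; have := tail_min_le (v - indicator (A :\ ord0)) ni.
  by rewrite !weightE !indicatorE !inE ni (negPf ni).
congr (- _); have [i0 vi0 le0] := full_min_attained v.
have E A : full_min (v - indicator A) =
    full_min v - 1 + [disjoint A & [set i | v i == full_min v]]%:Z.
  apply: full_minP => [|i].
    have [dis | /pred0Pn [i /andP[/= iA]]] := boolP [disjoint _ & _].
      exists i0; rewrite weightDE weightNE indicatorE.
      have : i0 \notin A by rewrite (disjointFl dis) // inE vi0.
      by move=> /negPf ->; lia.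
    rewrite inE => /eqP vi; exists i.
    by rewrite weightDE weightNE indicatorE vi iA; lia.
  rewrite weightDE weightNE indicatorE; have := le0 i.
  case: (boolP (i \in A)) => iA; last by case: [disjoint _ & _]; lia.
  have [dis|_] := boolP [disjoint _ & _]; last by lia.
  by have := disjointFr dis iA; rewrite inE => /eqP; lia.
under eq_bigr => A _ do rewrite E mulrDr.
rewrite big_split /= (set_sign_toggle (i := ord0)) // add0r.
have [/const_weightP cv | ncv] := boolP (const_weight v).
  rewrite (bigD1 set0) //= big1 => [|A nA].
    rewrite /set_sign cards0 expr0 mul1r addr0.
    by rewrite (_ : [disjoint _ & _] = true) //; apply/pred0P => i; rewrite /= inE.
  rewrite (_ : [disjoint _ & _] = false) ?mulr0 //; apply/negP => dis.
  case/set0Pn: nA => i iA; have := disjointFr dis iA.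
  by rewrite inE (cv i i0) vi0 eqxx.
have [i vi] : exists i, v i != full_min v.
  apply/existsP; apply: contraR ncv; rewrite negb_exists => /forallP h.
  apply/const_weightP => i j; have := h i; have := h j.
  by rewrite !negbK => /eqP -> /eqP ->.
apply: (set_sign_toggle (i := i)) => A.
have nB : i \notin [set i | v i == full_min v] by rewrite inE.
congr (Posz (nat_of_bool _)); apply/idP/idP => dis.
  by apply: disjointWl dis; apply: subset_trans (subD1set _ _) (subsetUr _ _).
apply/pred0P => j /=; apply/negP => /andP[jA jB].
have ji : j != i by apply: contraNneq nB => <-.
have jA' : j \in A :\ i by move: jA; rewrite !inE (negPf ji).
by move: jB; rewrite /= (disjointFr dis jA').
Qed.

Let ones : weight d := [ffun=> 1].

Let ones_const : const_weight ones.
Proof. by apply/const_weightP => i j; rewrite !ffunE. Qed.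

(** Complements turn the addition of [A] into a subtraction, up to a shift by (1, ..., 1) and the
    sign (-1)^d. *)
Lemma neg_count_sum v :
  \sum_A set_sign A * (neg_count (v + indicator A))%:Z = - ((-1) ^+ d * (const_weight v)%:Z).
Proof.
transitivity (\sum_A set_sign A * (neg_count (v + ones - indicator (~: A)))%:Z).
  by apply: eq_bigr => A _; rewrite indicatorC opprB addrACA subrr addr0.
rewrite (set_sign_setC (fun A => (neg_count (v + ones - indicator A))%:Z)).
by rewrite neg_count_difference mulrN [v + _]addrC const_weightDl.
Qed.

(** The second hypothesis says that the formal combination [X] vanishes modulo (1, ..., 1). Grouping
    its terms by the representative [nu], whose coordinate 0 is 0, reduces the claim to single
    classes. *)
Lemma class_function_sum (X : seq (int * weight d)) (phi : weight d -> int) :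
  (forall v w, const_weight (v - w) -> phi v = phi w) ->
  (forall y, \sum_(x <- X) x.1 * (const_weight (y - x.2))%:Z = 0) ->
  \sum_(x <- X) x.1 * phi x.2 = 0.
Proof.
move=> hphi hX; pose nu v : weight d := v - [ffun=> v ord0].
have nuc v : const_weight (nu v - v).
  by apply/const_weightP => i j; rewrite !weightE !ffunE; lia.
have nuE v w : (nu v == nu w) = const_weight (nu v - w).
  apply/eqP/idP => [->|/const_weightP h]; first exact: nuc.
  apply/ffunP => i; have := h i ord0; rewrite !weightE !ffunE; lia.
pose U := undup [seq nu x.2 | x <- X].
have E x : x \in X -> x.1 * phi x.2 =
    \sum_(u <- U) phi u * (x.1 * (u == nu x.2)%:Z).
  move=> xX; have xU : nu x.2 \in U by rewrite mem_undup; apply/mapP; exists x.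
  rewrite (bigD1_seq (nu x.2)) ?undup_uniq //= eqxx mulr1 big1 => [|u /negPf ->].
    by rewrite addr0 mulrC (hphi _ _ (nuc x.2)).
  by rewrite !mulr0.
rewrite big_seq (eq_bigr _ E) -big_seq exchange_big /= big_seq big1 // => u.
rewrite mem_undup => /mapP [x0 _ ->]; rewrite -mulr_sumr.
under eq_bigr => x _ do rewrite nuE.
by rewrite hX mulr0.
Qed.

Variables (J : pred 'X_{1..d}) (boxes : seq 'X_{1..d}) (M : nat).
Hypothesis JP : monomial_ideal J boxes M.

Let fiber y : int := \sum_(p <- boxes) (const_weight (mnm_weight p - y))%:Z.

Lemma quot_countE y : (quot_count boxes y)%:Z = (neg_count y)%:Z + fiber y.
Proof.
rewrite PoszD; congr (_ + _); rewrite /fiber -sum1_count big_mkcond.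
by rewrite (big_morph Posz PoszD (erefl _)); apply: eq_bigr => p _; rewrite /of_weight; case: ifP.
Qed.

Let nonneg_const v := const_weight v && (0 <= v ord0).

(** The common coordinate of the difference is some [k <= p' ord0]. For each [k] the only candidate
    is [p = p' - 1_A - k (1, ..., 1)]; once nonnegative it is a box, because it divides the box
    [p']. *)
Let nonneg_fiber p' A : p' \in boxes ->
  \sum_(p <- boxes) (nonneg_const (mnm_weight p' - mnm_weight p - indicator A))%:Z =
  \sum_(k < (p' ord0).+1) [forall i, ((i \in A) + k <= p' i)%N]%:Z :> int.
Proof.
move=> p'boxes.
pose eqk p k := [forall i, p' i == (p i + (i \in A) + k)%N].
have E p : (nonneg_const (mnm_weight p' - mnm_weight p - indicator A))%:Z =
    \sum_(k < (p' ord0).+1) (eqk p k)%:Z :> int.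
  have [h|nh] := boolP (nonneg_const _); last first.
    rewrite big1 // => k _; rewrite (_ : eqk p k = false) //; apply: contraNF nh => /forallP h.
    have hh i : (mnm_weight p' - mnm_weight p - indicator A) i = k%:Z.
      by rewrite !weightE indicatorE; have /eqP := h i; lia.
    by rewrite /nonneg_const hh andbT; apply/const_weightP => i j; rewrite !hh.
  have /andP[/const_weightP hc h0] := h.
  pose k := absz ((mnm_weight p' - mnm_weight p - indicator A)%R ord0).
  have kE i : p' i = (p i + (i \in A) + k)%N.
    have := hc i ord0; have : k%:Z = (mnm_weight p' - mnm_weight p - indicator A) ord0.
      by rewrite gez0_abs.
    by rewrite !weightE !indicatorE; lia.
  have kK : (k < (p' ord0).+1)%N by rewrite ltnS (kE ord0) leq_addl.
  rewrite (bigD1 (Ordinal kK)) //= big1 => [|l nl].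
    by rewrite addr0 (_ : eqk p k) //; apply/forallP => i; rewrite -kE.
  rewrite (_ : eqk p l = false) //; apply/negP => /forallP /(_ ord0) /eqP.
  move: (kE ord0) => e1 e2; have /addnI lk : (p ord0 + (ord0 \in A) + k = p ord0 + (ord0 \in A) + l)%N.
    by rewrite -e1 -e2.
  by case/eqP: nl; apply: val_inj.
under eq_bigr => p _ do rewrite E.
rewrite exchange_big /=; apply: eq_bigr => k _.
have [/forallP h | /forallPn [i hi]] := boolP [forall i, ((i \in A) + k <= p' i)%N]; last first.
  rewrite big1 // => p _; rewrite (_ : eqk p k = false) //.
  by apply: contraNF hi => /forallP /(_ i) /eqP ->; lia.
pose p0 := [multinom (p' i - ((i \in A) + k))%N | i < d].
have p0E : eqk p0 k by apply/forallP => i; rewrite mnmE; have := h i; lia.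
rewrite (bigD1_seq p0) ?(mi_uniq JP) //=; last first.
  rewrite (mi_box JP); move: p'boxes; rewrite (mi_box JP); apply: contra => Jp0.
  have -> : p' = (p0 + [multinom ((i \in A) + k)%N | i < d])%MM.
    by apply/mnmP => i; rewrite mnmDE !mnmE; have := h i; lia.
  exact: (mi_up JP).
rewrite p0E big1 ?addr0 // => p np; rewrite (_ : eqk p k = false) //.
apply/negP => /forallP hp; case/eqP: np; apply/mnmP => i.
by have /eqP := hp i; move/forallP/(_ i)/eqP: p0E; lia.
Qed.

(** For fixed [k], a coordinate of [p'] below [k] excludes every [A], and one above [k] can be
    toggled in [A]. Only [p'] constant equal to [k], with [A] empty, survives. *)
Let nonneg_fiber_sum p' : p' \in boxes ->
  \sum_A set_sign A * \sum_(p <- boxes)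
    (nonneg_const (mnm_weight p' - mnm_weight p - indicator A))%:Z =
  (const_weight (mnm_weight p'))%:Z.
Proof.
move=> p'boxes; under eq_bigr => A _ do rewrite nonneg_fiber // mulr_sumr.
rewrite exchange_big /=.
have E k : \sum_A set_sign A * [forall i, ((i \in A) + k <= p' i)%N]%:Z =
    [forall i, p' i == k]%:Z.
  have [/forallP h|] := boolP [forall i, p' i == k].
    rewrite (bigD1 set0) //= big1 => [|A /set0Pn [i iA]].
      rewrite /set_sign cards0 mul1r addr0 (_ : [forall _, _] = true) //.
      by apply/forallP => i; rewrite inE; have := h i; lia.
    rewrite (_ : [forall _, _] = false) ?mulr0 //; apply/negP => /forallP /(_ i).
    by rewrite iA; have := h i; lia.
  case/forallPn => i; rewrite neq_ltn => /orP[lt|lt].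
    rewrite big1 // => A _; rewrite (_ : [forall _, _] = false) ?mulr0 //.
    by apply/negP => /forallP /(_ i); lia.
  apply: (set_sign_toggle (i := i)) => A; congr (Posz (nat_of_bool _)).
  apply: eq_forallb => j; rewrite !inE; case: (j =P i) => [->|_] //=.
  by lia.
under eq_bigr => k _ do rewrite E.
have [/const_weightP h|nh] := boolP (const_weight _).
  rewrite (bigD1 ord_max) //= big1 => [|k nk].
    rewrite (_ : [forall _, _] = true) //; apply/forallP => i.
    by have := h i ord0; rewrite !weightE; lia.
  rewrite (_ : [forall _, _] = false) //; apply/negP => /forallP /(_ ord0) /eqP E0.
  by case/eqP: nk; apply: val_inj.
rewrite big1 // => k _; rewrite (_ : [forall _, _] = false) //.
apply: contraNF nh => /forallP h; apply/const_weightP => i j.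
by rewrite !weightE; have := h i; have := h j; lia.
Qed.

Let fiber_sum : \sum_(p <- boxes) \sum_A set_sign A * fiber (mnm_weight p + indicator A) =
  (1 + (-1) ^+ d) * fiber 0.
Proof.
pose v p' p A := mnm_weight p' - mnm_weight p - indicator A.
have split p' p A : (const_weight (v p' p A))%:Z =
    (nonneg_const (v p' p A))%:Z + (nonneg_const (v p p' (~: A)))%:Z :> int.
  (* Exchanging the boxes and complementing [A] replaces a constant [k] by [-1 - k], so exactly one
     of the two is nonnegative. *)
  have vE : v p p' (~: A) = - (v p' p A + ones).
    by apply/ffunP => i; rewrite /v indicatorC !weightE !indicatorE !ffunE; lia.
  rewrite /nonneg_const vE const_weightN [_ + ones]addrC (const_weightDl _ ones_const).
  have o0 : ones ord0 = 1 by exact: ffunE.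
  case: (const_weight _) => //=; rewrite weightNE (weightDE ones) o0.
  by move: (v p' p A ord0 : int) => x; case: (leP 0 x); case: (leP 0 (- (1 + x))); lia.
have F0 : fiber 0 = \sum_(p <- boxes) (const_weight (mnm_weight p))%:Z.
  by apply: eq_bigr => p _; rewrite subr0.
rewrite mulrDl mul1r.
have -> : \sum_(p <- boxes) \sum_A set_sign A * fiber (mnm_weight p + indicator A) =
   \sum_(p' <- boxes) (\sum_A set_sign A * \sum_(p <- boxes) (nonneg_const (v p' p A))%:Z) +
   \sum_(p <- boxes) (\sum_A set_sign A * \sum_(p' <- boxes) (nonneg_const (v p p' (~: A)))%:Z).
  transitivity (\sum_(p <- boxes) \sum_A set_sign A * \sum_(p' <- boxes) (nonneg_const (v p' p A))%:Z +
     \sum_(p <- boxes) (\sum_A set_sign A * \sum_(p' <- boxes) (nonneg_const (v p p' (~: A)))%:Z)).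
    rewrite -big_split; apply: eq_bigr => p _ /=; rewrite -big_split; apply: eq_bigr => A _ /=.
    rewrite -mulrDr -big_split; congr (_ * _); apply: eq_bigr => p' _.
    by rewrite /= -split /v opprD addrA.
  congr (_ + _); rewrite exchange_big /= [RHS]exchange_big /=; apply: eq_bigr => A _.
  by rewrite -!mulr_sumr exchange_big.
congr (_ + _).
  by rewrite F0 big_seq [RHS]big_seq; apply: eq_bigr => p' /nonneg_fiber_sum.
rewrite F0 mulr_sumr big_seq [RHS]big_seq; apply: eq_bigr => p /nonneg_fiber_sum <-.
by rewrite (set_sign_setC (fun A => \sum_(p' <- boxes) (nonneg_const (v p p' A))%:Z)).
Qed.

(* The hypothesis says that the sum of the [c t] times the character of [g t] is
   1 - Z (1 - t_1) ... (1 - t_d), with Z the character of S / I. *)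
Lemma euler_identity (T : finType) (c : T -> int) (g : T -> weight d) :
  (forall y, \sum_t c t * (neg_count (y - g t))%:Z = (quot_count boxes y)%:Z) ->
  \sum_t c t * (quot_count boxes (g t))%:Z = 0.
Proof.
move=> hc.
(* The combination that has to vanish: the sum of the [c t] times the character of [g t], minus 1,
   plus Z (1 - t_1) ... (1 - t_d). *)
pose X := [seq (c t, g t) | t <- enum T] ++ (-1, 0) ::
  [seq (set_sign A, mnm_weight p + indicator A) | p <- boxes, A <- enum {set 'I_d}].
have XE (phi : weight d -> int) : \sum_(x <- X) x.1 * phi x.2 =
    \sum_t c t * phi (g t) - phi 0 +
    \sum_(p <- boxes) \sum_A set_sign A * phi (mnm_weight p + indicator A).
  rewrite big_cat big_map big_enum big_cons /= mulN1r addrA; congr (_ + _).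
  by rewrite big_allpairs_dep; apply: eq_bigr => p _; rewrite big_enum.
have hX y : \sum_(x <- X) x.1 * (const_weight (y - x.2))%:Z = 0.
  rewrite (XE (fun x => (const_weight (y - x))%:Z)).
  (* The indicator of constant weights is written as a signed sum of values of [neg_count], to which
     the hypothesis applies. *)
  have E t : c t * (const_weight (y - g t))%:Z =
      - \sum_A set_sign A * (c t * (neg_count (y - indicator A - g t))%:Z).
    rewrite -[(const_weight _)%:Z]opprK -neg_count_difference mulrN mulr_sumr; congr (- _).
    by apply: eq_bigr => A _; rewrite mulrCA [y - _ - _]addrAC.
  under eq_bigr => t _ do rewrite E.
  rewrite sumrN exchange_big /=.
  under eq_bigr => A _ do rewrite -mulr_sumr hc quot_countE mulrDr.
  rewrite big_split /= neg_count_difference subr0 opprD opprK.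
  have -> : \sum_(p <- boxes) \sum_A set_sign A * (const_weight (y - (mnm_weight p + indicator A)))%:Z =
      \sum_A set_sign A * fiber (y - indicator A).
    rewrite exchange_big; apply: eq_bigr => A _; rewrite mulr_sumr; apply: eq_bigr => p _.
    rewrite -[const_weight (y - _)]const_weightN.
    by congr (_ * Posz (nat_of_bool (const_weight _))); rewrite !opprB addrA.
  ring.
have q_class v w : const_weight (v - w) -> (quot_count boxes v)%:Z = (quot_count boxes w)%:Z.
  by move/(quot_count_const boxes) ->.
have := class_function_sum q_class hX; rewrite (XE (fun v => (quot_count boxes v)%:Z)).
(* The two parts of [quot_count] contribute -(-1)^d z(0) and (1 + (-1)^d) z(0), where z(0) =
   [fiber 0]; their sum is q(0). *)
have -> : \sum_(p <- boxes) \sum_A set_sign A * (quot_count boxes (mnm_weight p + indicator A))%:Z =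
    (quot_count boxes 0)%:Z.
  have E p : \sum_A set_sign A * (quot_count boxes (mnm_weight p + indicator A))%:Z =
      - ((-1) ^+ d * (const_weight (mnm_weight p))%:Z) +
      \sum_A set_sign A * fiber (mnm_weight p + indicator A).
    rewrite -neg_count_sum -big_split; apply: eq_bigr => A _ /=.
    by rewrite quot_countE mulrDr.
  rewrite (eq_bigr _ (fun p _ => E p)) big_split /= fiber_sum sumrN -mulr_sumr.
  have -> : \sum_(p <- boxes) (const_weight (mnm_weight p))%:Z = fiber 0.
    by apply: eq_bigr => p _; rewrite subr0.
  by rewrite quot_countE neg_count0; ring.
by rewrite subrK.
Qed.

End EulerIdentity.

(** * The theorem *)

Section ExtGroups.
Variables (R : realType) (d : nat) (I : Cpoly R d -> Prop).
Variable F : equivariant_resolution I.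
Local Notation S := (Cpoly R d).

Lemma res_diff_graded i : graded_mx (@res_wt _ _ _ F i.+1) (@res_wt _ _ _ F i) (res_diff F i).
Proof. by move=> j k; apply/T_semi_invariantP/res_diff_equivariant. Qed.

Lemma res_aug_graded : graded_mx (@res_wt _ _ _ F 0) (fun _ => 0) (res_aug F).
Proof.
by move=> j k; rewrite subr0 (ord1 k); apply/T_semi_invariantP/res_aug_equivariant.
Qed.

Lemma Hom_weightP i (c : 'cV[S]_(res_rk F i)) : Hom_weight 0 c <->
  graded_mx (@res_wt _ _ _ F i) (fun _ => 0) c /\ forall j, I (c j 0).
Proof.
split=> [h | [gc Ic] j].
  split=> [j k|j]; last by have [] := h j.
  by rewrite subr0 (ord1 k); have [_ /T_semi_invariantP] := h j; rewrite add0r.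
split=> //; apply/T_semi_invariantP; rewrite add0r.
by have := gc j 0; rewrite subr0.
Qed.

(** A homomorphism of trace zero is multiplication by 0, so it vanishes on the generators. *)
Lemma Ext0_mult0 w : Ext0_mult F w 0 0.
Proof.
apply: dim_quot_self => [|c [_ _ /= hc]].
  split=> // [u v -> ->|a u ->]; [exact: addr0 | exact: scaler0].
apply/matrixP => j k; rewrite (ord1 k) [RHS]mxE.
by have := hc (delta_mx 0 j); rewrite mul0r -rowE mxE.
Qed.

End ExtGroups.

Lemma Ext0_class_coef0 (R : realType) e n (I : Cpoly R e.+2 -> Prop)
    (F : equivariant_resolution I) : T_fixed_point n I -> Ext0_class_coef F 0 0.
Proof.
move=> /(@T_fixed_monomial R e.+2 n I isT) [J [boxes [M [JP IJ]]]].
pose wt i := @res_wt _ _ _ F i.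
have image f : supported J f <-> exists v : 'rV_(res_rk F 0), f = (v *m res_aug F) 0 0.
  by rewrite -IJ; apply: res_aug_image.
have gD := @res_diff_graded R e.+2 I F.
have gaug := @res_aug_graded R e.+2 I F.
have [h [hdim hsum]] := column_complex_dims JP gD gaug (@res_bounded _ _ _ F) image
  (@res_exact0 _ _ _ F) (@res_exact _ _ _ F).
(* All generators of the resolution, each counted with the sign of its degree. *)
pose T := {i : 'I_(res_len F).+1 & 'I_(res_rk F i)}.
pose c (t : T) : int := (-1) ^+ (tag t).
pose g (t : T) := wt (tag t) (tagged t).
have sumE (phi : weight e.+2 -> nat) : \sum_t c t * (phi (g t))%:Z =
    \sum_(i < (res_len F).+1) (-1) ^+ i * (\sum_(j < res_rk F i) phi (wt i j))%N%:Z.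
  rewrite big_tagged; apply: eq_bigr => i _.
  by rewrite (big_morph Posz PoszD (erefl _)) mulr_sumr.
have := euler_identity JP (c := c) (g := g); rewrite sumE -hsum => h0.
have {}h0 : \sum_(i < res_len F) (-1) ^+ i * (h i)%:Z = 0.
  apply: h0 => y; rewrite (sumE (fun v => neg_count (y - v))).
  exact: (row_complex_euler JP gD gaug (@res_bounded _ _ _ F) image
    (@res_exact0 _ _ _ F) (@res_exact _ _ _ F)).
(* The connecting homomorphism raises the degree by one, which reverses the sign of the sum. *)
exists (fun i => if i is i'.+1 then h i' else 0%N).
  case=> [|i]; first exact: Ext0_mult0.
  have JE (k : nat) (b : 'cV_(res_rk F k)) : entries_in J b <-> forall j, I (b j 0).
    by split=> [Jb j|Ib j l]; [apply/IJ/Jb | rewrite (ord1 l); apply/IJ/Ib].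
  apply: eq_dim_quot (hdim i) => z; split.
  - by move=> [[gz /JE Iz] Dz]; split=> //; apply/Hom_weightP.
  - by move=> [/Hom_weightP [gz Iz] Dz _]; split=> //; split=> //; apply/JE.
  - by move=> [b [gb /JE Ib] zE]; exists b; split=> //; apply/Hom_weightP.
  - by move=> [b [/Hom_weightP [gb Ib] zE]]; exists b => //; split=> //; apply/JE.
apply/esym; transitivity (- \sum_(i < res_len F) (-1) ^+ i * (h i)%:Z); last by rewrite h0 oppr0.
rewrite big_ord_recl mulr0 add0r -sumrN.
by apply: eq_bigr => i _; rewrite /= exprS mulN1r mulNr.
Qed.

(** * The case of one variable *)

(** Division by a nonzero element of least degree. *)
Lemma principal_ideal1 (R : realType) (I : Cpoly R 1 -> Prop) : is_ideal I ->
  exists f, forall g, I g <-> exists a, g = a * f.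
Proof.
move=> idI; have [I0 ID IM] := idI.
have [all0 | /existsNP [f0 /not_implyP [If0 /eqP f00]]] := pselect (forall g, I g -> g = 0).
  by exists 0 => g; split=> [/all0 ->|[a ->]]; [exists 0; rewrite mulr0 | rewrite mulr0].
pose P k := `[< exists f, [/\ I f, f != 0 & msize f = k] >].
have exP : exists k, P k by exists (msize f0); apply/asboolP; exists f0.
case: (ex_minnP exP) => k /asboolP [f [If f0' fk]] mink; exists f => g.
split=> [|[a ->]]; last exact: IM.
(* A monomial in one variable is determined by its degree, so cancelling the leading term lowers
   [msize]. *)
have mnm1 (m m' : 'X_{1..1}) : mdeg m = mdeg m' -> m = m'.
  by rewrite !mdegE !big_ord1 => E; apply/mnmP => i; rewrite (ord1 i).
have [N] := ubnP (msize g); elim: N g => // N IH g ltN Ig.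
have [->|g0] := eqVneq g 0; first by exists 0; rewrite mul0r.
have lefg : (msize f <= msize g)%N by rewrite fk; apply: mink; apply/asboolP; exists g.
pose m := mlead g; pose q := (m - mlead f)%MM.
have dm : mdeg m = (mdeg (mlead f) + mdeg q)%N.
  rewrite /q; have le : (mlead f <= m)%MM.
    apply/mnm_lepP => i; move: lefg; rewrite -!mlead_deg // ltnS !mdegE !big_ord1.
    by rewrite (ord1 i).
  by rewrite -mdegD addmC submK.
have qm : (q + mlead f)%MM = m by apply: mnm1; rewrite mdegD dm addnC.
pose a := (mleadc g / mleadc f) *: 'X_[q] : Cpoly R 1.
have Ig' : I (g - a * f).
  by rewrite -mulN1r; apply: ID => //; apply: (IM _ _ (IM _ _ If)).
have [|b bE] := IH (g - a * f) _ Ig'; last first.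
  by exists (b + a); rewrite mulrDl -bE subrK.
rewrite -ltnS; apply: leq_trans ltN; rewrite ltnS -(mlead_deg g0) ltnS msizeE.
apply/bigmax_leqP_seq => m' m'g _.
have le : (mdeg m' <= mdeg m)%N.
  have := msuppB_le m'g; rewrite mem_cat => /orP[/msize_mdeg_lt|].
    by rewrite -mlead_deg.
  rewrite /a -scalerAl => /msuppZ_le /msuppM_le /allpairsP [[m1 m2] /= []].
  rewrite msuppX inE => /eqP -> /msize_mdeg_lt; rewrite -mlead_deg // ltnS => le ->.
  by rewrite mdegD dm addnC leq_add2r.
rewrite ltn_neqAle le andbT; apply: contraTneq m'g => /mnm1 ->.
have : ('X_[q] * f)@_(q + mlead f) = mleadc f by rewrite mulrC mcoeffMX.
rewrite qm mcoeff_msupp negbK mcoeffB /a -scalerAl mcoeffZ => ->.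
by rewrite divfK ?subrr // mleadc_eq0.
Qed.

Lemma const_weight1 (v : weight 1) : const_weight v.
Proof. by apply/const_weightP => i j; rewrite (ord1 i) (ord1 j). Qed.

Lemma graded_mx1 (R : realType) m n (a : 'I_m -> weight 1) (b : 'I_n -> weight 1)
  (A : 'M[Cpoly R 1]_(m, n)) : graded_mx a b A.
Proof. by move=> i j m' _; apply: const_weight1. Qed.

(* In one variable T is trivial and I is free, so that its resolution splits. *)
Lemma Ext0_class_coef1 (R : realType) (I : Cpoly R 1 -> Prop)
    (F : equivariant_resolution I) : is_ideal I -> Ext0_class_coef F 0 0.
Proof.
move=> idI; have [f If] := principal_ideal1 idI.
exists (fun=> 0%N); last by rewrite big1 // => i _; rewrite mulr0.
case=> [|i]; first exact: Ext0_mult0.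
have [I0 ID IM] := idI.
have sI : subspace (V := 'cV_(res_rk F i)) (fun b => forall j, I (b j 0)).
  split=> [j|u v Iu Iv j|c u Iu j]; rewrite mxE //; first exact: ID.
  exact: IM.
have [J0 JD JZ] := sI.
have cobP (z : 'cV_(res_rk F i.+1)) : Ext_coboundary 0 z <->
    exists b : 'cV_(res_rk F i), (forall j, I (b j 0)) /\ z = res_diff F i *m b.
  split=> [[b [/Hom_weightP [_ Ib] zE]]|[b [Ib zE]]]; exists b; split=> //.
  by apply/Hom_weightP; split=> //; apply: graded_mx1.
apply: dim_quot_self => [|z [/Hom_weightP [_ Iz] Dz _]].
  split=> [|u v /cobP [b [Ib ->]] /cobP [b' [Ib' ->]]|c u /cobP [b [Ib ->]]]; apply/cobP.
  - by exists 0; rewrite mulmx0.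
  - by exists (b + b'); rewrite mulmxDr; split=> //; apply: JD.
  - by exists (c%:MP *: b); rewrite -scalemxAr; split=> //; apply: JZ.
apply/cobP; have [f0|f0] := eqVneq f 0.
  exists 0; split=> //; rewrite mulmx0; apply/matrixP => j k; rewrite (ord1 k) [RHS]mxE.
  by have /If [a ->] := Iz j; rewrite f0 mulr0.
have augI j : I (res_aug F j 0).
  by apply/res_aug_image; exists (delta_mx 0 j); rewrite -rowE mxE.
have /fin_all_exists [a aE] j : exists a, res_aug F j 0 = a * f by apply/If/augI.
(* Dividing the augmentation by [f] turns [F] into a resolution of the free module S. *)
pose aug' : 'cV_(res_rk F 0) := \col_j a j.
have augE : res_aug F = f *: aug'.
  by apply/matrixP => j k; rewrite !mxE (ord1 k) aE mulrC.
have fI := mulfI f0.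
have aug0 (v : 'rV_(res_rk F 0)) : v *m aug' = 0 <-> v *m res_aug F = 0.
  rewrite augE -scalemxAr; split=> [->|/matrixP h]; first by rewrite scaler0.
  by apply/matrixP => j k; apply: fI; have := h j k; rewrite !mxE mulr0.
have [sigma sE] : exists v : 'rV_(res_rk F 0), f = (v *m res_aug F) 0 0.
  by apply/res_aug_image/If; exists 1; rewrite mul1r.
have sE' : sigma *m aug' = 1%:M.
  apply/matrixP => j k; rewrite (ord1 j) (ord1 k); apply: fI.
  transitivity ((f *: (sigma *m aug')) 0 0); first by rewrite [RHS]mxE.
  have one : (1%:M : 'M[Cpoly R 1]_1) 0 0 = 1 by rewrite mxE.
  by rewrite one mulr1 scalemxAr -augE -sE.
(* The homotopy for the element 1 contracts the complex, so the cocycle [z] is [D (s z)]. *)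
have [s [_ _ hs]] := @null_homotopy R 1 (res_rk F) (@res_wt _ _ _ F) (res_diff F) aug'
  (fun i => @graded_mx1 _ _ _ _ _ _) (@graded_mx1 _ _ _ _ _ _)
  (fun v => iff_trans (aug0 v) (res_exact0 v)) (@res_exact _ _ _ F)
  1 0 sigma (@graded_mx1 _ _ _ _ _ _) (fun m _ => const_weight1 _) sE'.
exists (s i *m z); split=> [j|].
  rewrite mxE; apply: (big_ind I) => // k _; exact: (IM _ _ (Iz k)).
by rewrite -[LHS]mul1mx -(hs i) mulmxDl -[X in X + _]mulmxA Dz mulmx0 add0r mulmxA.
Qed.

Theorem proposition3p3 (R : realType) (d n : nat) (I : Cpoly R d -> Prop)
    (F : equivariant_resolution I) :
  (0 < d)%N ->
  T_fixed_point n I ->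
  odd d
  \/ (d = 2%N \/ d = 4%N)
  \/ (d = 0 %[mod 4] /\ is_Z_pi_with I (fun pi => psize pi = 1%N))
  \/ (d = 8%N /\ is_Z_pi_with I (fun pi => (psize pi < 7)%N))
  \/ (d = 8%N /\
      is_Z_pi_with I (fun pi => [\/ pcharacter pi = character9 d,
                                   pcharacter pi = character10 d
                                 | pcharacter pi = character14 d]))
  \/ (d = 12%N /\ is_Z_pi_with I (fun pi => (psize pi < 5)%N)) ->
  exists2 c : int, Ext0_class_coef F 0 c & 0 <= c.
Proof.
move=> d0 fixI _; exists 0 => //.
case: d d0 I F fixI => [|[|e]] // _ I F fixI; last exact: Ext0_class_coef0 fixI.
by apply: Ext0_class_coef1; case: fixI.
Qed.
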